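(* Let $X,\mu,G=(\mathcal N,\mathcal A),\mathcal S,c,(c_{ij}),(s_i),(a_{ij}),(b_{ij})$ be data as in the context, and assume: (a) $c: X\times\mathcal S\to\mathbb R\cup\{+\infty\}$ is lower semi-continuous and bounded from below; (b) $X$ is compact; (c) for every $(i,j)\in\mathcal A$, $c_{ij}:\mathbb R\to\mathbb R\cup\{+\infty\}$ is convex and lower semi-continuous; (d) the Monge-type problem (M) described in the context admits a feasible solution. Then the optimal value of the Kantorovich-type problem (K) described in the context is equal to $$\sup_{\psi\in\mathbb R^{|\mathcal N|}} q(\psi),$$ where the dual function $q:\mathbb R^{|\mathcal N|}\to\mathbb R$ is given by $$q(\psi)=\int_X \min_{i\in\mathcal S}\{c(x,i)-\psi_i\}\,\mathrm d\mu(x)+\sum_{i\in\mathcal N}\psi_i s_i+\sum_{(i,j)\in\mathcal A}\ \min_{p\in[a_{ij},b_{ij}]}\{c_{ij}(p)-(\psi_i-\psi_j)p\}.$$ Moreover, the infimum in (K) is attained at an optimal solution $(\pi^*,p^* )\in\mathcal M_+(X\times\mathcal S)\times\mathbb R^{|\mathcal A|}$.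
   Context: Setting. $X$ is a (Hausdorff) topological space equipped with a non-negative (Radon) measure $\mu$; $\mathcal B(X)$ denotes the $\mu$-measurable subsets of $X$. $G=(\mathcal N,\mathcal A)$ is a directed graph with finite node set $\mathcal N\subset\mathbb N$ and arc set $\mathcal A\subset\mathcal N\times\mathcal N$. Each node $i\in\mathcal N$ has a net supply $s_i\in\mathbb R$ (of any sign). $\mathcal S\subset\mathcal N$ is a subset of nodes (the endpoints), with the discrete topology. $c:X\times\mathcal S\to\mathbb R\cup\{+\infty\}$ is the assignment cost, $c_{ij}:\mathbb R\to\mathbb R\cup\{+\infty\}$, $(i,j)\in\mathcal A$, are arc costs, and the scalars $a_{ij},b_{ij}$ are lower and upper arc flow limits. Problem (M): minimize $$\int_X c(x,T(x))\,\mathrm d\mu(x)+\sum_{(i,j)\in\mathcal A}c_{ij}(p_{ij})$$ over (measurable) maps $T:X\to\mathcal S$ and vectors $p=(p_{ij})_{(i,j)\in\mathcal A}\in\mathbb R^{|\mathcal A|}$ subject to $$\sum_{j:(i,j)\in\mathcal A}p_{ij}-\sum_{j:(j,i)\in\mathcal A}p_{ji}=s_i-\mu(T^{-1}(i))\quad\forall i\in\mathcal S,$$ $$\sum_{j:(i,j)\in\mathcal A}p_{ij}-\sum_{j:(j,i)\in\mathcal A}p_{ji}=s_i\quad\forall i\in\mathcal N\setminus\mathcal S,$$ $$a_{ij}\le p_{ij}\le b_{ij}\quad\forall(i,j)\in\mathcal A.$$ A feasible solution of (M) is a pair $(T,p)$ satisfying these constraints. (Existence of one implies in particular $\mu(X)=\sum_{i\in\mathcal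 N}s_i$.) Problem (K): let $\mathcal M_+(X\times\mathcal S)$ be the set of non-negative (finite Radon) measures on $X\times\mathcal S$; for such $\pi$ and $A\subset X$ measurable write $\pi(A,i)=\pi(A\times\{i\})$. Minimize $$\sum_{i\in\mathcal S}\int_X c(x,i)\,\mathrm d\pi(x,i)+\sum_{(i,j)\in\mathcal A}c_{ij}(p_{ij})$$ over $\pi\in\mathcal M_+(X\times\mathcal S)$ and $p\in\mathbb R^{|\mathcal A|}$ subject to $$\sum_{j:(i,j)\in\mathcal A}p_{ij}-\sum_{j:(j,i)\in\mathcal A}p_{ji}=s_i-\pi(X,i)\quad\forall i\in\mathcal S,$$ $$\sum_{j:(i,j)\in\mathcal A}p_{ij}-\sum_{j:(j,i)\in\mathcal A}p_{ji}=s_i\quad\forall i\in\mathcal N\setminus\mathcal S,$$ $$\sum_{i\in\mathcal S}\pi(A,i)=\mu(A)\quad\forall A\in\mathcal B(X),$$ $$a_{ij}\le p_{ij}\le b_{ij}\quad\forall(i,j)\in\mathcal A.$$ *)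

(* Defs.v *)
From HB Require Import structures.
From mathcomp Require Import all_boot all_order all_algebra.
From mathcomp Require Import all_classical all_reals all_analysis.

Set Implicit Arguments.
Unset Strict Implicit.
Unset Printing Implicit Defensive.
Import Order.TTheory GRing.Theory Num.Theory.
Import numFieldNormedType.Exports.

Local Open Scope classical_set_scope.
Local Open Scope ring_scope.
Local Open Scope ereal_scope.

(* MathComp-Analysis only puts sigma-algebras on pointed, i.e. nonempty, types. *)
Definition borelType (T : ptopologicalType) := g_sigma_algebraType (@open T).

HB.instance Definition _ (T : ptopologicalType) :=
  Measurable.on (borelType T).

(* Locally finite and inner regular with respect to compact sets; the definition
   is meant for Hausdorff T, where compact sets are closed, hence Borel. *)
Definition radon (R : realType) (T : ptopologicalType)
    (mu : set (borelType T) -> \bar R) : Prop :=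
  (forall x : T, exists U : set T, [/\ open U, U x & mu U < +oo]) /\
  (forall B : set (borelType T), measurable B ->
     mu B = ereal_sup [set mu K | K in [set K : set T | compact K /\ K `<=` B]]).

(* [mu_ext mu] is the outer measure generated by the Borel measure [mu]; on this
   class it is the completion of [mu], and on Borel sets it agrees with [mu]. *)
Definition mu_measurable (R : realType) (T : ptopologicalType)
    (mu : set (borelType T) -> \bar R) : set (set T) :=
  (mu_ext mu).-caratheodory.

Definition econvex (R : realType) (f : R -> \bar R) : Prop :=
  forall (x y t : R), (0 <= t <= 1)%R ->
    f (t * x + (1 - t) * y)%R <= t%:E * f x + (1 - t)%:E * f y.

(* The node set S as a type with the discrete topology. The proof of
   nonemptiness only provides the base point that measurable types require. *)
Definition endpoint (N : finType) (S : {set N}) (S0 : exists i, i \in S) : Type :=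
  {i : N | i \in S}.

HB.instance Definition _ (N : finType) (S : {set N}) (S0 : exists i, i \in S) :=
  Finite.copy (endpoint S0) {i : N | i \in S}.
HB.instance Definition _ (N : finType) (S : {set N}) (S0 : exists i, i \in S) :=
  isPointed.Build (endpoint S0) (exist _ (xchoose S0) (xchooseP S0)).
HB.instance Definition _ (N : finType) (S : {set N}) (S0 : exists i, i \in S) :=
  DiscreteTopology.copy (endpoint S0) (discrete_topology {i : N | i \in S}).

(* Missing join in the library. *)
HB.instance Definition _ (T U : ptopologicalType) :=
  Pointed.on (T * U)%type.

Definition arcType (N : finType) (A : {set N * N}) : Type := {e : N * N | e \in A}.

HB.instance Definition _ (N : finType) (A : {set N * N}) :=
  Finite.copy (arcType A) {e : N * N | e \in A}.

Definition net_outflow (R : realType) (N : finType) (A : {set N * N})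
    (p : arcType A -> R) (i : N) : R :=
  (\sum_(e : arcType A | (sval e).1 == i) p e
   - \sum_(e : arcType A | (sval e).2 == i) p e)%R.

Section Problems.
Context (R : realType) (X : ptopologicalType)
  (mu : {measure set (borelType X) -> \bar R})
  (N : finType) (A : {set N * N}) (S : {set N}) (S0 : exists i, i \in S)
  (s : N -> R) (c : X * endpoint S0 -> \bar R)
  (carc : arcType A -> R -> \bar R) (a b : arcType A -> R).

Definition within_limits (p : arcType A -> R) : Prop :=
  forall e, (a e <= p e <= b e)%R.

Definition monge_feasible (T : X -> endpoint S0) (p : arcType A -> R) : Prop :=
  [/\ forall B : set (endpoint S0), mu_measurable mu (T @^-1` B),
      forall i : endpoint S0,
        (net_outflow p (sval i))%:E = (s (sval i))%:E - mu_ext mu (T @^-1` [set i]),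
      forall i : N, i \notin S -> net_outflow p i = s i
    & within_limits p].

Definition kantorovich_cost
    (pi : {finite_measure set (borelType (X * endpoint S0)%type) -> \bar R})
    (p : arcType A -> R) : \bar R :=
  \sum_(i : endpoint S0) \int[pi]_(z in [set: X] `*` [set i]) c z
  + \sum_(e : arcType A) carc e (p e).

Definition kantorovich_feasible
    (pi : {finite_measure set (borelType (X * endpoint S0)%type) -> \bar R})
    (p : arcType A -> R) : Prop :=
  [/\ radon pi,
      forall i : endpoint S0,
        (net_outflow p (sval i))%:E = (s (sval i))%:E - pi ([set: X] `*` [set i]),
      forall i : N, i \notin S -> net_outflow p i = s i,
      forall E : set X, mu_measurable mu E ->
        \sum_(i : endpoint S0) mu_ext pi (E `*` [set i]) = mu_ext mu E
    & within_limits p].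

Definition kantorovich_value : \bar R :=
  ereal_inf [set v | exists pi p,
    kantorovich_feasible pi p /\ v = kantorovich_cost pi p].

(* The infimum over an arc's flow interval is a minimum when the arc cost is
   lower semi-continuous. The value is +oo when costs are infinite on a set of
   positive measure or on a whole flow interval, whence the codomain. *)
Definition dual_function (psi : N -> R) : \bar R :=
  \int[mu]_x \big[mine/+oo]_(i : endpoint S0) (c (x, i) - (psi (sval i))%:E)
  + (\sum_(i : N) psi i * s i)%:E
  + \sum_(e : arcType A)
      ereal_inf [set carc e r - ((psi (sval e).1 - psi (sval e).2) * r)%:E
                | r in [set r : R | (a e <= r <= b e)%R]].

End Problems.

(* Main.v *)
(* Splitting [mu] as [\sum_i nu_i], the problem is to minimize a convex cost over
   pairs (nu, p) subject to finitely many linear balance equations.  Setwise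
   limits of [nu] along an ultrafilter are again measures because they are
   dominated by the finite measure [mu], and the cost is lower semi-continuous
   along such limits.  Hence the convex set of attained (residual, cost bound)
   pairs has a point nearest to (0, M), and if every dual value is at most [M] the
   hyperplane through that point forces it to be (0, M): this gives both strong
   duality and an optimal solution.  A dual value is itself attained by a
   Lagrangian minimizer that concentrates [nu_i] where [i] is the argmin. *)
Require Import Defs.
From HB Require Import structures.
From mathcomp Require Import all_boot all_order all_algebra.
From mathcomp Require Import all_classical all_reals all_analysis.
From mathcomp Require Import measurable_realfun.
From mathcomp Require Import ring lra.

Set Implicit Arguments.
Unset Strict Implicit.
Unset Printing Implicit Defensive.
Import Order.TTheory GRing.Theory Num.Theory.
Import numFieldNormedType.Exports.

Local Open Scope classical_set_scope.
Local Open Scope ring_scope.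
Local Open Scope ereal_scope.

(** The residual has finitely many coordinates, so once the pairs are formed the argument is
    Euclidean, with no minimax theorem and no constraint qualification. The dual supremum is not
    claimed to be attained, so a vertical supporting hyperplane is harmless: large multiples of its
    normal push dual values above any given [M]. Setwise limits handle every measurable cost bounded
    below. Semi-continuity of [c] thus enters through Borel measurability, and compactness of [X]
    through finiteness of [mu]. Infinite values shape the statements: integrands are shifted to be
    nonnegative before any linearity is used, costs are recorded by real upper bounds, and a dual
    supremum equal to [+oo] is treated apart. In that last case the Monge feasible pair supplies the
    plan. *)

(** * Nearest points of convex sets and multipliers *)

Lemma nearest_point_obtuse (R : realType) (N : finType)
    (C : set ((N -> R) * R)) (M : R) (z : (N -> R) * R) :
  (forall u v t, C u -> C v -> (0 <= t <= 1)%R ->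
     C (fun i => t * u.1 i + (1 - t) * v.1 i, t * u.2 + (1 - t) * v.2)%R) ->
  C z ->
  (forall u, C u -> ((z.2 - M) ^+ 2 + \sum_i z.1 i ^+ 2 <=
                     (u.2 - M) ^+ 2 + \sum_i u.1 i ^+ 2)%R) ->
  forall u, C u ->
    (0 <= (u.2 - z.2) * (z.2 - M) + \sum_i (u.1 i - z.1 i) * z.1 i)%R.
Proof.
move=> Cconv Cz zmin u Cu; rewrite leNgt; apply/negP.
set V := ((u.2 - z.2) * (z.2 - M) + _)%R => V0.
pose D := ((u.2 - z.2) ^+ 2 + \sum_i (u.1 i - z.1 i) ^+ 2)%R.
have D0 : (0 <= D)%R.
  by rewrite addr_ge0 ?sqr_ge0// sumr_ge0// => i _; exact: sqr_ge0.
have key t : (0 <= t <= 1)%R -> (0 <= 2 * t * V + t ^+ 2 * D)%R.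
  move=> t01; have /= := zmin _ (Cconv _ _ _ Cu Cz t01).
  rewrite -subr_ge0.
  have -> : (\sum_i (t * u.1 i + (1 - t) * z.1 i) ^+ 2 =
     \sum_i z.1 i ^+ 2 + 2 * t * (\sum_i (u.1 i - z.1 i) * z.1 i)
     + t ^+ 2 * \sum_i (u.1 i - z.1 i) ^+ 2)%R.
    rewrite !mulr_sumr -!big_split/=; apply: eq_bigr => i _; ring.
  set a := (\sum_i z.1 i ^+ 2)%R => h.
  rewrite (le_trans h)// le_eqVlt; apply/orP; left; apply/eqP.
  by rewrite /V /D; ring.
have DV : (0 < D - V)%R by lra.
(* The quadratic is smallest at [- V / D]. Adding [- V] to the denominator keeps [t] between 0 and
   1, covers [D = 0], and still gives a negative value. *)
have t01 : (0 <= - V / (D - V) <= 1)%R.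
  apply/andP; split; first by rewrite divr_ge0//; lra.
  by rewrite ler_pdivrMr//; lra.
have := key _ t01.
have -> : (2 * (- V / (D - V)) * V + (- V / (D - V)) ^+ 2 * D =
   - (V ^+ 2 * (D - 2 * V)) / (D - V) ^+ 2)%R by field; rewrite gt_eqF.
rewrite leNgt => /negP; apply.
rewrite pmulr_llt0 ?invr_gt0 ?exprn_gt0// oppr_lt0 mulr_gt0//; last by lra.
by rewrite exprn_even_gt0//= lt_eqF.
Qed.

(* If [(0, M)] were not the nearest point [z], the hyperplane through [z]
   orthogonal to [z - (0, M)] would yield a multiplier contradicting [dual];
   when that hyperplane is vertical ([z.2 = M]) the multiplier is scaled up. *)
Lemma nearest_point_dual (R : realType) (N : finType)
    (C : set ((N -> R) * R)) (m M : R) (z : (N -> R) * R) :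
  (forall u v t, C u -> C v -> (0 <= t <= 1)%R ->
     C (fun i => t * u.1 i + (1 - t) * v.1 i, t * u.2 + (1 - t) * v.2)%R) ->
  (forall y t t', C (y, t) -> (t <= t')%R -> C (y, t')) ->
  (forall u, C u -> (m <= u.2)%R) ->
  C z ->
  (forall u, C u -> ((z.2 - M) ^+ 2 + \sum_i z.1 i ^+ 2 <=
                     (u.2 - M) ^+ 2 + \sum_i u.1 i ^+ 2)%R) ->
  (forall psi : N -> R,
     exists2 u, C u & (u.2 + \sum_i psi i * u.1 i <= M)%R) ->
  (forall i, z.1 i = 0%R) /\ z.2 = M.
Proof.
move=> Cconv Cup Clb Cz zmin dual.
have obtuse := nearest_point_obtuse Cconv Cz zmin.
have Vsplit u : (\sum_i (u.1 i - z.1 i) * z.1 i =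
    \sum_i z.1 i * u.1 i - \sum_i z.1 i ^+ 2)%R.
  by rewrite -sumrB; apply: eq_bigr => i _; ring.
have S0 : (0 <= \sum_i z.1 i ^+ 2)%R.
  by rewrite sumr_ge0// => i _; exact: sqr_ge0.
(* Costs may be raised inside [C], so a nearest point below level [M] could be lifted to [M] and
   come strictly closer. *)
have zM : (M <= z.2)%R.
  rewrite leNgt; apply/negP => zM.
  have : C (z.1, M) by apply: (Cup _ z.2); [case: (z) Cz|exact: ltW].
  move/zmin => /=; rewrite subrr expr0n/= add0r gerDr leNgt => /negP; apply.
  by rewrite exprn_even_gt0//= subr_eq0 lt_eqF.
have {zM} : (M < z.2)%R \/ z.2 = M.
  by move: zM; rewrite le_eqVlt => /orP[/eqP|]; [right|left].
case=> [zM|zM].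
  have d0 : (0 < z.2 - M)%R by rewrite subr_gt0.
  (* With this slope every point of [C] has Lagrangian value at least [z.2], which exceeds [M]. *)
  have [u Cu] := dual (fun i => z.1 i / (z.2 - M))%R.
  have -> : (\sum_i z.1 i / (z.2 - M) * u.1 i =
             (\sum_i z.1 i * u.1 i) / (z.2 - M))%R.
    by rewrite mulr_suml; apply: eq_bigr => i _; ring.
  rewrite -lerBrDl ler_pdivrMr// => h.
  by have := obtuse _ Cu; rewrite Vsplit; nra.
split => //; have {S0} : (0 < \sum_i z.1 i ^+ 2)%R \/ (\sum_i z.1 i ^+ 2 = 0)%R.
  by move: S0; rewrite le_eqVlt => /orP[/eqP|]; [right|left].
case=> [S0|/eqP].
  (* On [C] the pairing with [z.1] is at least the squared norm of [z.1]. After scaling it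
     contributes at least the distance from [m] to [M] plus 1, too much for a cost bounded below by
     [m] to stay under [M]. *)
  have [u Cu] := dual (fun i => (`|M - m| + 1) / (\sum_i z.1 i ^+ 2) * z.1 i)%R.
  have -> : (\sum_i (`|M - m| + 1) / (\sum_i z.1 i ^+ 2) * z.1 i * u.1 i =
     (`|M - m| + 1) / (\sum_i z.1 i ^+ 2) * \sum_i z.1 i * u.1 i)%R.
    by rewrite mulr_sumr; apply: eq_bigr => i _; ring.
  have := obtuse _ Cu; rewrite Vsplit zM subrr mulr0 add0r subr_ge0 => h h'.
  have : ((`|M - m| + 1) <=
    (`|M - m| + 1) / (\sum_i z.1 i ^+ 2) * \sum_i z.1 i * u.1 i)%R.
    rewrite -mulrA ler_peMr ?addr_ge0// mulrC ler_pdivlMr// ?mul1r//.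
  have := Clb _ Cu; have := ler_norm (M - m); lra.
rewrite psumr_eq0 => [/allP h i|i _]; last exact: sqr_ge0.
by have := h i (mem_index_enum i); rewrite sqrf_eq0 => /eqP.
Qed.

(** * Lower semi-continuity and limits along ultrafilters *)

Lemma lte_EFin_dense (R : realType) (r : R) (x : \bar R) :
  r%:E < x -> exists2 u : R, (r < u)%R & u%:E < x.
Proof.
case: x => [x| |]//; last by exists (r + 1)%R; [lra|exact: ltry].
by rewrite lte_fin => rx; exists ((r + x) / 2)%R; rewrite ?lte_fin; lra.
Qed.

(** This is [l <= liminf f] along [U], tested on real thresholds so that infinite values need no
    separate treatment. *)
Definition lsc_along (R : realType) (J : Type) (U : set_system J)
    (f : J -> \bar R) (l : \bar R) :=
  forall r : R, r%:E < l -> \forall n \near U, r%:E < f n.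

Lemma lsc_alongD (R : realType) (J : Type) (U : set_system J) (f g : J -> \bar R)
    (k l : \bar R) : Filter U -> -oo < k -> -oo < l ->
  lsc_along U f k -> lsc_along U g l -> lsc_along U (fun n => f n + g n) (k + l).
Proof.
move=> FU kNy lNy fk gl r rkl.
have [r1 [r2 [-> r1k r2l]]] : exists r1 r2 : R,
    [/\ r = (r1 + r2)%R, r1%:E < k & r2%:E < l].
  case: k l kNy lNy rkl {fk gl} => [k| |]// [l| |]// _ _.
  - rewrite -EFinD lte_fin => rkl; pose d := ((k + l - r) / 2)%R.
    by exists (k - d)%R, (l - d)%R; rewrite !lte_fin /d; split; lra.
  - move=> _; exists (k - 1)%R, (r - (k - 1))%R; rewrite ltry lte_fin; split => //; lra.
  - move=> _; exists (r - (l - 1))%R, (l - 1)%R; rewrite ltry lte_fin; split => //; lra.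
  - by move=> _; exists r, 0%R; rewrite addr0 !ltry.
by apply: filterS2 (fk _ r1k) (gl _ r2l) => n; rewrite EFinD; exact: lteD.
Qed.

Lemma lsc_along_sum (R : realType) (J : Type) (U : set_system J) (I : finType)
    (f : I -> J -> \bar R) (l : I -> \bar R) : Filter U ->
  (forall i, -oo < l i) -> (forall i, lsc_along U (f i) (l i)) ->
  lsc_along U (fun n => \sum_i f i n) (\sum_i l i).
Proof.
move=> FU lNy fl.
suff h (t : seq I) : -oo < \sum_(i <- t) l i /\
    lsc_along U (fun n => \sum_(i <- t) f i n) (\sum_(i <- t) l i).
  exact: (h (index_enum I)).2.
elim: t => [|i t [t0 ft]].
  rewrite big_nil; split; first exact: ltNyr.
  by move=> r r0; apply: nearW => n; rewrite big_nil.
have -> : (fun n => \sum_(j <- i :: t) f j n) =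
          (fun n => f i n + \sum_(j <- t) f j n).
  by apply/funext => n; rewrite big_cons.
rewrite big_cons; split; last exact: lsc_alongD.
by move: (lNy i) t0; rewrite !ltNye adde_eq_ninfty negb_or => -> ->.
Qed.

Lemma lsc_along_cvg (R : realType) (J : Type) (U : set_system J)
    (f : J -> R) (l : R) : Filter U ->
  f @ U --> l -> lsc_along U (EFin \o f) l%:E.
Proof.
move=> FU fl r; rewrite lte_fin => rl.
have h : \forall n \near U, (r < f n)%R := fl _ (lt_nbhsr rl).
by apply: filterS h => n /=; rewrite lte_fin.
Qed.

Lemma lsc_along_le (R : realType) (J : Type) (U : set_system J)
    (f : J -> \bar R) (g : J -> R) (k : \bar R) (l : R) : ProperFilter U ->
  lsc_along U f k -> g @ U --> l -> (\forall n \near U, f n <= (g n)%:E) -> k <= l%:E.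
Proof.
move=> FU fk gl fg; rewrite leNgt; apply/negP => lk.
have [r lr rk] := lte_EFin_dense lk.
have h : \forall n \near U, (g n < r)%R := gl _ (lt_nbhsl lr).
have [n [[/= h1 h2] h3]] := filter_ex (filterI (filterI h (fk _ rk)) fg).
by have := lt_le_trans h2 h3; rewrite lte_fin ltNge (ltW h1).
Qed.

Lemma ultra_fmap (J K : Type) (U : set_system J) (f : J -> K) :
  UltraFilter U -> UltraFilter (f @ U).
Proof.
move=> UU; split; first exact: fmap_proper_filter.
move=> G GG sUG; apply/seteqP; split => // A GA.
have [//|UnA] := in_ultra_setVsetC (f @^-1` A) UU.
have /sUG GnA : (f @ U) (~` A) by [].
by have [x []] := filter_ex (filterI GA GnA).
Qed.

Lemma ultra_cvg_bounded (R : realType) (J : Type) (U : set_system J)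
    (f : J -> R) (a b : R) : UltraFilter U ->
  (forall n, a <= f n <= b)%R -> exists2 l, (a <= l <= b)%R & f @ U --> l.
Proof.
move=> UU fab; have := @segment_compact R a b.
rewrite compact_ultra => /(_ _ (ultra_fmap f UU)) [].
  by apply: (@filterE J U _ (f @^-1` [set` `[a, b]])) => n; rewrite /= in_itv/=.
by move=> l []; rewrite /= in_itv/= => lab fl; exists l.
Qed.

(* Domination by the finite measure [mu] turns the finite additivity that a
   setwise limit inherits into countable additivity. *)
Lemma setwise_ultralimit d (T : measurableType d) (R : realType)
    (U : set_system nat) (mu : {measure set T -> \bar R})
    (nu : nat -> {measure set T -> \bar R}) :
  UltraFilter U -> mu [set: T] < +oo ->
  (forall n B, measurable B -> nu n B <= mu B) ->
  exists nu' : {measure set T -> \bar R}, forall B, measurable B ->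
    nu' B <= mu B /\ fine (nu n B) @[n --> U] --> fine (nu' B).
Proof.
move=> UU muT numu.
have mufin B : measurable B -> mu B \is a fin_num.
  move=> mB; rewrite ge0_fin_numE// (le_lt_trans _ muT)// le_measure// inE//.
have nufin n B : measurable B -> nu n B \is a fin_num.
  move=> mB; rewrite ge0_fin_numE// (le_lt_trans (numu _ _ mB))//.
  by rewrite -ge0_fin_numE// mufin.
(* A measure must be nonnegative on all sets, so [l] is also constrained outside the sigma-algebra,
   where 0 serves as witness. *)
have /choice[l lP] (B : set T) : exists l : R, (0 <= l)%R /\ (measurable B ->
    (l <= fine (mu B))%R /\ fine (nu n B) @[n --> U] --> l).
  have [mB|mB] := pselect (measurable B); last by exists 0%R.
  have [l /andP[l0 lmu] nul] : exists2 l, (0 <= l <= fine (mu B))%R &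
      fine (nu n B) @[n --> U] --> l.
    apply: ultra_cvg_bounded => n; rewrite fine_ge0//= fine_le ?mufin ?nufin ?numu//.
  by exists l.
have l_ge0 B : 0 <= (EFin \o l) B by rewrite lee_fin (lP B).1.
have l0 : (EFin \o l) set0 = 0.
  apply/eqP; rewrite eq_le l_ge0 andbT lee_fin.
  by have [_ /(_ measurable0)[]] := lP set0; rewrite measure0.
have lsa : semi_sigma_additive (EFin \o l).
  move=> F mF tF mUF.
  have mFk k : measurable (\big[setU/set0]_(i < k) F i) by exact: bigsetU_measurable.
  have sF k : \big[setU/set0]_(i < k) F i `<=` \bigcup_n F n.
    by rewrite -bigcup_mkord => x [i _ Fx]; exists i.
  have diffE (m : {measure set T -> \bar R}) k :
      (forall B, measurable B -> m B \is a fin_num) ->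
      fine (m (\bigcup_n F n `\` \big[setU/set0]_(i < k) F i)) =
      (fine (m (\bigcup_n F n)) - \sum_(i < k) fine (m (F i)))%R.
    move=> mfin; rewrite measureD//; last by rewrite -ge0_fin_numE// mfin.
    rewrite setIidr// measure_bigsetU// fineB ?mfin//; last first.
      by apply/sum_fin_numP => i _ _; exact: mfin.
    by rewrite sum_fine// => i _; exact: mfin.
  (* The tail of [l] is squeezed between 0 and the tail of [mu]: for each [nu n] the tail is the
     mass of a difference set, and the inequalities pass to the limit in [n]. *)
  have bnd k : (0 <= l (\bigcup_n F n) - \sum_(i < k) l (F i) <=
      fine (mu (\bigcup_n F n)) - \sum_(i < k) fine (mu (F i)))%R.
    have h : (fine (nu n (\bigcup_n F n)) - \sum_(i < k) fine (nu n (F i)))%R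
        @[n --> U] --> (l (\bigcup_n F n) - \sum_(i < k) l (F i))%R.
      apply: cvgB; first exact: ((lP _).2 _).2.
      by apply: cvg_big => [|i _]; [exact: add_continuous|exact: ((lP _).2 _).2].
    have bnd n : (0 <= fine (nu n (\bigcup_n F n)) - \sum_(i < k) fine (nu n (F i)) <=
        fine (mu (\bigcup_n F n)) - \sum_(i < k) fine (mu (F i)))%R.
      have mD : measurable (\bigcup_n F n `\` \big[setU/set0]_(i < k) F i).
        exact: measurableD.
      rewrite -(diffE (nu n) k (nufin n)) -(diffE mu k mufin) fine_ge0//=.
      by rewrite fine_le ?mufin ?nufin ?numu.
    apply/andP; split.
      apply: (@ler_cvg_to nat U _ R (cst 0%R) _ _ _ (cvg_cst _) h).
      by apply: nearW => n; have /andP[] := bnd n.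
    apply: (@ler_cvg_to nat U _ R _ (cst _) _ _ h (cvg_cst _)).
    by apply: nearW => n; have /andP[] := bnd n.
  have hmu : (\sum_(0 <= i < k) fine (mu (F i)))%R @[k --> \oo] -->
      fine (mu (\bigcup_n F n)).
    have : \sum_(0 <= i < k) mu (F i) @[k --> \oo] --> (fine (mu (\bigcup_n F n)))%:E.
      by rewrite fineK ?mufin//; exact: measure_semi_sigma_additive.
    move/fine_cvg; apply: cvg_trans; apply: near_eq_cvg; apply: nearW => k /=.
    by rewrite sum_fine// => i _; exact: mufin.
  rewrite /comp; under eq_fun do rewrite sumEFin.
  apply: cvg_EFin; first exact: nearW.
  apply: (@squeeze_cvgr _ _ _ _ (fun k => l (\bigcup_n F n) -
    (fine (mu (\bigcup_n F n)) - \sum_(0 <= i < k) fine (mu (F i))))%R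
    (cst (l (\bigcup_n F n)))).
  - by apply: nearW => k /=; have := bnd k; rewrite !big_mkord; lra.
  - rewrite -[X in _ --> X]subr0 -[X in (_ - X)%R](subrr (fine (mu (\bigcup_n F n)))).
    by apply: cvgB; [exact: cvg_cst|apply: cvgB => //; exact: cvg_cst].
  - exact: cvg_cst.
pose m : {measure set T -> \bar R} := HB.pack (EFin \o l)
  (isMeasure.Build _ T R (EFin \o l) l0 l_ge0 lsa).
exists m => B mB; have [_ /(_ mB)[lmu nul]] := lP B; split => //.
by rewrite -(fineK (mufin _ mB)) lee_fin.
Qed.

Import HBNNSimple.

(** The integral is a supremum over simple functions below [f]. For each of these it is a finite
    combination of masses, which converges along [U], and a supremum of convergent functionals is
    lower semi-continuous. *)
Lemma ge0_integral_lsc_along d (T : measurableType d) (R : realType)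
    (U : set_system nat) (nu : nat -> {measure set T -> \bar R})
    (nu' : {measure set T -> \bar R}) (f : T -> \bar R) :
  Filter U -> (forall n, nu n [set: T] < +oo) -> nu' [set: T] < +oo ->
  (forall B, measurable B -> fine (nu n B) @[n --> U] --> fine (nu' B)) ->
  (forall x, 0 <= f x) ->
  lsc_along U (fun n => \int[nu n]_x f x) (\int[nu']_x f x).
Proof.
move=> FU nuT nu'T nunu' f0 r.
have fin (m : {measure set T -> \bar R}) B :
    m [set: T] < +oo -> measurable B -> m B \is a fin_num.
  by move=> mT mB; rewrite ge0_fin_numE// (le_lt_trans _ mT)// le_measure// inE.
rewrite ge0_integralTE// => /ereal_sup_gt[_ [h hf <-] rh].
have hE (m : {measure set T -> \bar R}) : m [set: T] < +oo ->
    sintegral m h =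
    (\sum_(y <- finmap.enum_fset (fset_set (range h))) y * fine (m (h @^-1` [set y])))%:E.
  move=> mT; rewrite sintegralE fsbig_finite//= -sumEFin; apply: eq_bigr => y _.
  by rewrite EFinM fineK// fin.
have : lsc_along U (fun n => sintegral (nu n) h) (sintegral nu' h).
  rewrite hE//; under eq_fun do rewrite hE//.
  apply: lsc_along_cvg; apply: cvg_big => [|y _]; first exact: add_continuous.
  by apply: cvgM; [exact: cvg_cst|exact: nunu'].
move=> /(_ _ rh); apply: filterS => n /lt_le_trans; apply.
by rewrite ge0_integralTE//; apply: ereal_sup_ubound; exists h.
Qed.

(** * Integrals of functions bounded below *)

(** The integral of [f] may be [+oo], which rules out linearity for integrable functions. For
    [m < 0] the identity [f^+ - m = (f - m) + f^-] has only nonnegative terms, and [f^- <= - m] has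
    finite integral, so it can be moved across. *)
Lemma integral_shift d (T : measurableType d) (R : realType)
    (nu : {measure set T -> \bar R}) (f : T -> \bar R) (m : R) :
  nu [set: T] < +oo -> measurable_fun [set: T] f -> (forall x, m%:E <= f x) ->
  \int[nu]_x f x = \int[nu]_x (f x - m%:E) + m%:E * nu [set: T].
Proof.
move=> nuT mf fm.
have g0 x : 0 <= f x - m%:E by rewrite sube_ge0.
have mg : measurable_fun [set: T] (fun x => f x - m%:E).
  by apply: emeasurable_funB => //; exact: measurable_cst.
have [m0|m0] := leP 0%R m.
  rewrite -integral_cst// -ge0_integralD//.
  by apply: eq_integral => x _; rewrite subeK.
have nuTfin : nu [set: T] \is a fin_num by rewrite ge0_fin_numE.
have fnM x : f^\- x <= (- m)%:E.
  by rewrite funenegE ge_max EFinN leeN2 fm -EFinN lee_fin oppr_ge0 ltW.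
have mfn : measurable_fun [set: T] f^\- by exact: measurable_funeneg.
have mfp : measurable_fun [set: T] f^\+ by exact: measurable_funepos.
have intfn : \int[nu]_x f^\- x \is a fin_num.
  rewrite ge0_fin_numE ?integral_ge0//.
  apply: (@le_lt_trans _ _ (\int[nu]_x (cst (- m)%:E) x)).
    by apply: ge0_le_integral => //; move=> x _;
      rewrite ?funeneg_ge0//= lee_fin oppr_ge0 ltW.
  by rewrite integral_cst// ltey_eq fin_numM.
have : \int[nu]_x f^\+ x + \int[nu]_x (cst (- m)%:E) x =
       \int[nu]_x (f x - m%:E) + \int[nu]_x f^\- x.
  rewrite -!ge0_integralD//; last by move=> x _; rewrite lee_fin oppr_ge0 ltW.
  apply: eq_integral => x _.
  rewrite funeposE funenegE; have := fm x; case: (f x) => [y| |]//= _.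
    rewrite -!EFin_max -!EFinD; congr _%:E.
    by rewrite !maxEle; do 2 case: ifPn; lra.
  by rewrite maxye maxNye adde0 !addye.
rewrite integral_cst// EFinN mulNe => h.
have mnu : m%:E * nu [set: T] \is a fin_num by rewrite fin_numM.
have alg (p q y z : \bar R) : y \is a fin_num -> z \is a fin_num ->
    p - y = q + z -> p - z = q + y.
  case: y => [y| |]//; case: z => [z| |]// _ _; case: p => [p| |]; case: q => [q| |]//.
  by move=> [?]; congr _%:E; lra.
rewrite integralE; exact: (alg _ _ _ _ mnu intfn h).
Qed.

Lemma integral_lsc_along d (T : measurableType d) (R : realType)
    (U : set_system nat) (nu : nat -> {measure set T -> \bar R})
    (nu' : {measure set T -> \bar R}) (f : T -> \bar R) (m : R) :
  Filter U -> (forall n, nu n [set: T] < +oo) -> nu' [set: T] < +oo ->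
  (forall B, measurable B -> fine (nu n B) @[n --> U] --> fine (nu' B)) ->
  measurable_fun [set: T] f -> (forall x, m%:E <= f x) ->
  lsc_along U (fun n => \int[nu n]_x f x) (\int[nu']_x f x).
Proof.
move=> FU nuT nu'T nunu' mf fm.
have g0 x : 0 <= f x - m%:E by rewrite sube_ge0.
have fin (k : {measure set T -> \bar R}) : k [set: T] < +oo ->
    m%:E * k [set: T] = (m * fine (k [set: T]))%:E.
  by move=> kT; rewrite EFinM fineK// ge0_fin_numE.
rewrite (integral_shift nu'T mf fm) fin//.
under eq_fun do rewrite (integral_shift (nuT _) mf fm) fin//.
apply: lsc_alongD => //.
- by rewrite (lt_le_trans (ltNyr 0))// integral_ge0.
- exact: ltNyr.
- exact: ge0_integral_lsc_along.
- by apply: lsc_along_cvg; apply: cvgM; [exact: cvg_cst|exact: nunu'].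
Qed.

Lemma le_integral_bounded_below d (T : measurableType d) (R : realType)
    (nu : {measure set T -> \bar R}) (f g : T -> \bar R) (m : R) :
  nu [set: T] < +oo -> measurable_fun [set: T] f -> measurable_fun [set: T] g ->
  (forall x, m%:E <= f x) -> (forall x, f x <= g x) ->
  \int[nu]_x f x <= \int[nu]_x g x.
Proof.
move=> nuT mf mg fm fg; have gm x : m%:E <= g x by exact: le_trans (fm x) (fg x).
rewrite (integral_shift nuT mf fm) (integral_shift nuT mg gm) leeD2r//.
apply: ge0_le_integral => //.
- by move=> x _; rewrite sube_ge0.
- by apply: emeasurable_funB => //; exact: measurable_cst.
- by apply: emeasurable_funB => //; exact: measurable_cst.
- by move=> x _; exact: leeB.
Qed.

Lemma integral_ge_lbound d (T : measurableType d) (R : realType)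
    (nu : {measure set T -> \bar R}) (f : T -> \bar R) (m : R) :
  nu [set: T] < +oo -> measurable_fun [set: T] f -> (forall x, m%:E <= f x) ->
  (m * fine (nu [set: T]))%:E <= \int[nu]_x f x.
Proof.
move=> nuT mf fm; rewrite (integral_shift nuT mf fm) EFinM fineK ?ge0_fin_numE//.
by rewrite leeDr// integral_ge0// => x _; rewrite sube_ge0.
Qed.

Lemma integralB_cst d (T : measurableType d) (R : realType)
    (nu : {measure set T -> \bar R}) (f : T -> \bar R) (m r : R) :
  nu [set: T] < +oo -> measurable_fun [set: T] f -> (forall x, m%:E <= f x) ->
  \int[nu]_x (f x - r%:E) = \int[nu]_x f x - (r * fine (nu [set: T]))%:E.
Proof.
move=> nuT mf fm.
have mg : measurable_fun [set: T] (fun x => f x - r%:E).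
  by apply: emeasurable_funB => //; exact: measurable_cst.
have gm x : (m - r)%:E <= f x - r%:E by rewrite EFinB leeB.
rewrite (integral_shift nuT mf fm) (integral_shift nuT mg gm).
rewrite -(@fineK _ (nu [set: T])) ?ge0_fin_numE// -!EFinM -addeA -EFinD/=.
congr (_ + _%:E); last by ring.
apply: eq_integral => x _; rewrite -addeA; congr (_ + _).
by rewrite -EFinD; congr _%:E; ring.
Qed.

(** * Splittings of a finite measure into finitely many summands *)

Lemma measure_bigcup_fin d (T : measurableType d) (R : realType) (I : finType)
    (mu : {measure set T -> \bar R}) (A : I -> set T) :
  (forall i, measurable (A i)) -> trivIset [set: I] A ->
  mu (\bigcup_i A i) = \sum_i mu (A i).
Proof.
move=> mA tA; rewrite measure_fin_bigcup//; last exact: finite_finset.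
rewrite [RHS]fsbig_seq ?index_enum_uniq//; apply: eq_fsbigl.
by apply/seteqP; split => i //= _; exact: mem_index_enum.
Qed.

Lemma measurable_bigmine d (T : measurableType d) (R : realType) (I : finType)
    (f : I -> T -> \bar R) :
  (forall i, measurable_fun [set: T] (f i)) ->
  measurable_fun [set: T] (fun x => \big[mine/+oo]_i f i x).
Proof.
move=> mf; elim: (index_enum I) => [|i t ih].
  by under eq_fun do rewrite big_nil; exact: measurable_cst.
by under eq_fun do rewrite big_cons; exact: measurable_mine.
Qed.

Lemma bigmine_attained (R : realType) (I : finType) (i0 : I) (f : I -> \bar R) :
  exists i, f i <= \big[mine/+oo]_i f i.
Proof.
elim/big_ind: _ => [|x y [i fi] [j fj]|i _]; first by exists i0; exact: leey.
- by have [_|_] := leP x y; [exists i|exists j].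
- by exists i.
Qed.

Definition measure_split d (T : measurableType d) (R : realType) (I : finType)
    (mu : {measure set T -> \bar R}) (nu : I -> {measure set T -> \bar R}) :=
  forall B, measurable B -> \sum_i nu i B = mu B.

Section measure_split_lemmas.
Context d (T : measurableType d) (R : realType) (I : finType).
Variables (mu : {measure set T -> \bar R}) (nu : I -> {measure set T -> \bar R}).
Hypothesis muT : mu [set: T] < +oo.
Hypothesis nusplit : measure_split mu nu.

Lemma measure_split_le i B : measurable B -> nu i B <= mu B.
Proof.
move=> mB; rewrite -nusplit// (bigD1 i)//= leeDl// sume_ge0//.
Qed.

Lemma measure_split_lty i : nu i [set: T] < +oo.
Proof. by rewrite (le_lt_trans _ muT)// measure_split_le. Qed.

Lemma measure_split_integral (f : T -> \bar R) (m : R) :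
  measurable_fun [set: T] f -> (forall x, m%:E <= f x) ->
  \sum_i \int[nu i]_x f x = \int[mu]_x f x.
Proof.
move=> mf fm; rewrite (integral_shift muT mf fm) -nusplit//.
under eq_bigr do rewrite (integral_shift (measure_split_lty _) mf fm).
rewrite big_split/= fin_num_sume_distrr//; last first.
  by move=> i j _ _; rewrite ge0_adde_def ?inE.
congr (_ + _).
(* The sum of measures [msum] runs over natural numbers, so the family is listed as a sequence
   padded with the zero measure. *)
pose s := [seq nu i | i <- index_enum I].
pose k (n : nat) : {measure set T -> \bar R} :=
  nth (mzero : {measure set T -> \bar R}) s n.
have kE (F : {measure set T -> \bar R} -> \bar R) :
    \sum_(n < size s) F (k n) = \sum_i F (nu i).
  by rewrite -(big_mkord xpredT (fun n => F (k n))) -(big_nth _ xpredT F) big_map.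
rewrite -(kE (fun m' => \int[m']_x (f x - m%:E))).
rewrite -ge0_integral_measure_sum//.
  by apply: eq_measure_integral => B mB _; rewrite /= /msum (kE (fun m' => m' B)) nusplit.
by move=> x _; rewrite sube_ge0.
by apply: emeasurable_funB => //; exact: measurable_cst.
Qed.

End measure_split_lemmas.

(** Source of the convexity of the attained set. Shifting the integrand to a nonnegative one keeps
    the affine dependence on the measure valid for infinite integrals. *)
Lemma measure_split_conv d (T : measurableType d) (R : realType) (I : finType)
    (mu : {measure set T -> \bar R}) (nu nu' : I -> {measure set T -> \bar R})
    (t : R) : mu [set: T] < +oo ->
  measure_split mu nu -> measure_split mu nu' -> (0 <= t <= 1)%R ->
  exists2 nut : I -> {measure set T -> \bar R}, measure_split mu nut &
    (forall i B, nut i B = t%:E * nu i B + (1 - t)%:E * nu' i B) /\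
    (forall i f m, measurable_fun [set: T] f -> (forall x, m%:E <= f x) ->
      \int[nut i]_x f x = t%:E * \int[nu i]_x f x + (1 - t)%:E * \int[nu' i]_x f x).
Proof.
move=> muT snu snu' /andP[t0 t1]; have t1' : (0 <= 1 - t)%R by rewrite subr_ge0.
pose nut i : {measure set T -> \bar R} :=
  measure_add (mscale (NngNum t0) (nu i)) (mscale (NngNum t1') (nu' i)).
have nutE i B : nut i B = t%:E * nu i B + (1 - t)%:E * nu' i B.
  exact: measure_addE.
have snut : measure_split mu nut.
  move=> B mB; under eq_bigr do rewrite nutE.
  rewrite big_split/= -!ge0_sume_distrr// snu// snu'// -ge0_muleDl ?lee_fin//.
  by rewrite -EFinD addrC subrK mul1e.
exists nut => //; split => // i f m mf fm.
have fg0 x : 0 <= f x - m%:E by rewrite sube_ge0.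
have mg : measurable_fun [set: T] (fun x => f x - m%:E).
  by apply: emeasurable_funB => //; exact: measurable_cst.
have fE k (sk : measure_split mu k) := integral_shift (measure_split_lty muT sk i) mf fm.
rewrite !fE// nutE ge0_integral_measure_add//.
rewrite !ge0_integral_mscale//=.
have fin k (sk : measure_split mu k) : m%:E * k i [set: T] \is a fin_num.
  by rewrite fin_numM// ge0_fin_numE// (measure_split_lty muT sk).
have := fin _ snu'; have := fin _ snu.
move: (\int[nu i]_x _) (\int[nu' i]_x _) => p q fin1 fin2.
rewrite (muleDr (x := m%:E))//; last by rewrite ge0_adde_def// inE mule_ge0 ?lee_fin.
rewrite !muleDr ?fin_num_adde_defl// addeACA.
by rewrite (muleCA m%:E) (muleCA m%:E).
Qed.

Lemma measure_split_argmin d (T : measurableType d) (R : realType) (I : finType)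
    (i0 : I) (mu : {measure set T -> \bar R}) (f : I -> T -> \bar R) (m : R) :
  mu [set: T] < +oo -> (forall i, measurable_fun [set: T] (f i)) ->
  (forall i x, m%:E <= f i x) ->
  exists2 nu : I -> {measure set T -> \bar R}, measure_split mu nu &
    \sum_i \int[nu i]_x f i x = \int[mu]_x \big[mine/+oo]_i f i x.
Proof.
move=> muT mf fm; pose g x := \big[mine/+oo]_i f i x.
have mg : measurable_fun [set: T] g by exact: measurable_bigmine.
have gm x : m%:E <= g x by apply: le_bigmin => //; exact: leey.
pose B i := [set x | f i x <= g x].
have mB i : measurable (B i).
  by rewrite /B -[X in measurable X]setTI; exact: measurable_lee.
(* Ties go to the index of least rank, which makes the argmin cells disjoint. *)
pose A i := B i `\` \bigcup_(j in [set j | (enum_rank j < enum_rank i)%N]) B j.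
have mA i : measurable (A i).
  apply: measurableD => //; apply: fin_bigcup_measurable => //.
have tA : trivIset [set: I] A.
  apply/trivIsetP => i j _ _ ij; apply/seteqP; split => // x [[Bi nBi] [Bj nBj]].
  have [lt|lt|/val_inj/enum_rank_inj ij'] := ltngtP (enum_rank i) (enum_rank j).
  - by apply: nBj; exists i.
  - by apply: nBi; exists j.
  - by rewrite ij' eqxx in ij.
have cA : \bigcup_i A i = [set: T].
  apply/seteqP; split => // x _; have [i /asboolP Bi] := bigmine_attained i0 (f ^~ x).
  case: (@arg_minnP _ i (fun i => `[< B i x >]) (fun i => enum_rank i) Bi).
  move=> j /asboolP Bj jmin.
  exists j => //; split => // -[k /= kj /asboolP Bk].
  by have := jmin _ Bk; rewrite leqNgt kj.
pose nu i : {measure set T -> \bar R} := mrestr mu (mA i).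
have snu : measure_split mu nu.
  move=> C mC; rewrite -[in RHS](setIT C) -cA setI_bigcupr measure_bigcup_fin//.
    by move=> i; exact: measurableI.
  exact: trivIset_setIl.
exists nu => //; rewrite -(measure_split_integral muT snu mg gm).
(* [nu i] does not charge the complement of [A i], and on [A i] the function [f i] equals the
   minimum. *)
apply: eq_bigr => i _; apply: ae_eq_integral => //.
exists (~` A i); split => /=.
- exact: measurableC.
- by rewrite /nu/= /mrestr setICl measure0.
- apply: subsetC => x [fx _] _; apply/eqP; rewrite eq_le fx/=.
  exact: bigmin_le.
Qed.

(** * Lower semi-continuous functions on compact sets *)

(** The sublevel sets through points of [K] are nested, hence a filter base. A cluster point [x] is
    a minimizer: if [g y < g x], a neighbourhood of [x] would miss the sublevel set of [y]. *)
Lemma lsc_compact_min (R : realType) (X : topologicalType) (g : X -> \bar R)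
    (K : set X) : lower_semicontinuous g -> (forall x, -oo < g x) ->
  compact K -> K !=set0 -> exists2 x, K x & forall y, K y -> g x <= g y.
Proof.
move=> glsc gNy cK K0.
pose F := filter_from K (fun y => K `&` [set x | g x <= g y]).
have FF : ProperFilter F.
  apply: filter_from_proper; last by move=> y Ky; exists y; split => /=.
  apply: filter_from_filter => // x y Kx Ky.
  have [xy|yx] := leP (g x) (g y); [exists x => //|exists y => //];
    move=> z [Kz gz]; split; split => //=.
  - exact: le_trans gz xy.
  - exact: le_trans gz (ltW yx).
have FK : F K by case: K0 => x Kx; exists x => // z [].
have [x [Kx Fx]] := cK F FF FK; exists x => // y Ky; rewrite leNgt; apply/negP => yx.
have [r gyr] : exists r, g y = r%:E.
  by move: (gNy y) yx; case: (g y) => [r _ _|_|//]; [by exists r|rewrite ltNge leey].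
have [|V Vx Vr] := glsc x r; first by rewrite -gyr.
have Fy : F (K `&` [set x | g x <= g y]) by exists y.
have [z [[_ /= gzy] /Vr]] := Fx _ _ Fy Vx.
by rewrite -gyr ltNge gzy.
Qed.

Lemma lsc_sub_linear (R : realType) (g : R -> \bar R) (k : R) :
  lower_semicontinuous g -> lower_semicontinuous (fun r => g r - (k * r)%:E).
Proof.
move=> glsc x t; rewrite lteBrDr// -EFinD => /lte_EFin_dense[u tu ux].
have [V Vx Vu] := glsc x u ux.
have h : \forall y \near x, (k * y < u - t)%R.
  have kc : (k * y)%R @[y --> x] --> (k * x)%R.
    by apply: cvgM; [exact: cvg_cst|exact: cvg_id].
  by apply: (cvgr_lt _ kc); lra.
exists (V `&` [set y | (k * y < u - t)%R]); first exact: filterI.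
move=> y [/Vu uy ky]; have {}ky : (k * y < u - t)%R := ky.
by rewrite lteBrDr// -EFinD (lt_trans _ uy)// lte_fin; lra.
Qed.

Lemma sumeBr (R : realType) (I : finType) (F : I -> \bar R) (r : I -> R) :
  \sum_i (F i - (r i)%:E) = \sum_i F i - (\sum_i r i)%:E.
Proof. by rewrite big_split/= sumEFin sumrN. Qed.

Lemma sume_gtNy (R : realType) (I : finType) (F : I -> \bar R) :
  (forall i, -oo < F i) -> -oo < \sum_i F i.
Proof.
move=> FNy; elim/big_ind: _ => [|x y|i _]; [exact: ltNyr| |exact: FNy].
by rewrite !ltNye adde_eq_ninfty negb_or => -> ->.
Qed.

(** * Lagrangian duality for splittings and flows *)

Section transport.
Context (R : realType) d (T : measurableType d) (mu : {measure set T -> \bar R})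
  (N : finType) (A : {set N * N}) (S : {set N}) (S0 : exists i, i \in S)
  (s : N -> R) (f : endpoint S0 -> T -> \bar R)
  (carc : arcType A -> R -> \bar R) (a b : arcType A -> R) (m : R).
Hypotheses (muT : mu [set: T] < +oo)
  (mf : forall i, measurable_fun [set: T] (f i))
  (fm : forall i x, m%:E <= f i x)
  (carc_gtNy : forall e r, -oo < carc e r)
  (carc_convex : forall e, econvex (carc e))
  (carc_lsc : forall e, lower_semicontinuous (carc e)).

Definition transport_cost (nu : endpoint S0 -> {measure set T -> \bar R})
    (p : arcType A -> R) : \bar R :=
  \sum_i \int[nu i]_x f i x + \sum_e carc e (p e).

(** The inner sum is empty for [n] outside [S] and has one term otherwise, so one formula covers
    both kinds of balance equation. *)
Definition residual (nu : endpoint S0 -> {measure set T -> \bar R})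
    (p : arcType A -> R) (n : N) : R :=
  (s n - \sum_(i : endpoint S0 | sval i == n) fine (nu i [set: T])
   - net_outflow p n)%R.

Definition transport_dual (psi : N -> R) : \bar R :=
  \int[mu]_x \big[mine/+oo]_(i : endpoint S0) (f i x - (psi (sval i))%:E)
  + (\sum_(i : N) psi i * s i)%:E
  + \sum_(e : arcType A)
      ereal_inf [set carc e r - ((psi (sval e).1 - psi (sval e).2) * r)%:E
                | r in [set r : R | (a e <= r <= b e)%R]].

(** Summation by parts on the graph: grouping arcs by tail and by head turns the pairing of [psi]
    with the outflow into potential differences along arcs. *)
Lemma sum_residual nu p (psi : N -> R) :
  (\sum_n psi n * residual nu p n = \sum_n psi n * s n
   - \sum_i psi (sval i) * fine (nu i [set: T])
   - \sum_e (psi (sval e).1 - psi (sval e).2) * p e)%R.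
Proof.
have part (J : finType) (h : J -> N) (w : J -> R) :
    (\sum_n psi n * (\sum_(j | h j == n) w j) = \sum_j psi (h j) * w j)%R.
  under eq_bigr do rewrite mulr_sumr.
  rewrite [RHS](partition_big h xpredT)//=.
  by apply: eq_bigr => n _; apply: eq_bigr => j /eqP ->.
rewrite -(part _ sval (fun i => fine (nu i [set: T]))).
rewrite [X in (_ = _ - X)%R](_ : _ = \sum_n psi n * net_outflow p n)%R; last first.
  under [RHS]eq_bigr do rewrite mulrBr.
  rewrite sumrB (part _ (fun e : arcType A => (sval e).1)).
  rewrite (part _ (fun e : arcType A => (sval e).2)) -sumrB.
  by apply: eq_bigr => e _; rewrite mulrBl.
by rewrite -!sumrB; apply: eq_bigr => n _; rewrite /residual; ring.
Qed.

(** The Lagrangian separates, so [nu] and each [p e] can be minimized independently. *)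
Lemma transport_lagrangian nu p (psi : N -> R) : measure_split mu nu ->
  transport_cost nu p + (\sum_n psi n * residual nu p n)%:E =
  \sum_i \int[nu i]_x (f i x - (psi (sval i))%:E) + (\sum_n psi n * s n)%:E
  + \sum_e (carc e (p e) - ((psi (sval e).1 - psi (sval e).2) * p e)%:E).
Proof.
move=> snu; rewrite sumeBr.
under [in RHS]eq_bigr => i _.
  rewrite (integralB_cst (m := m))//; last exact: measure_split_lty muT snu i.
  over.
rewrite sumeBr sum_residual /transport_cost.
move: (\sum_i _) (\sum_e _) => [x| |] [y| |]//.
by congr _%:E; ring.
Qed.

Lemma transport_cost_ge :
  (forall e, (a e <= b e)%R) ->
  exists m' : R, forall nu p, measure_split mu nu -> within_limits a b p ->
    m'%:E <= transport_cost nu p.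
Proof.
move=> ab.
have /choice[k kP] e : exists k : R, forall r, (a e <= r <= b e)%R -> k%:E <= carc e r.
  have cab : compact `[a e, b e]%classic by exact: segment_compact.
  have [|r rab rmin] := lsc_compact_min (@carc_lsc e) (carc_gtNy e) cab.
    by exists (a e); rewrite /= in_itv/= lexx ab.
  have {}rmin r' : (a e <= r' <= b e)%R -> carc e r <= carc e r'.
    by move=> r'ab; apply: rmin; rewrite /= in_itv.
  move: (carc_gtNy e r) rmin; case: (carc e r) => [k| |]// _ rmin; first by exists k.
  (* An arc whose cost is infinite on its whole interval satisfies any bound. *)
  by exists 0%R => r' /rmin; rewrite leye_eq => /eqP ->; exact: leey.
(* The mass of [nu i] is only known to lie between 0 and that of [mu], hence the absolute value,
   which covers both signs of [m]. *)
exists (\sum_(i : endpoint S0) (- `|m| * fine (mu [set: T])) + \sum_e k e)%R.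
move=> nu p snu pab; rewrite EFinD -!sumEFin leeD//; apply: lee_sum => // e _; last first.
  by apply: kP; exact: pab.
have nuT := measure_split_lty muT snu e.
apply: le_trans (integral_ge_lbound nuT (@mf e) (@fm e)).
have h1 : (fine (nu e [set: T]) <= fine (mu [set: T]))%R.
  rewrite fine_le ?ge0_fin_numE// (measure_split_le snu)//.
have h2 : (0 <= fine (nu e [set: T]))%R by rewrite fine_ge0.
have h3 := ler_norm (- m); rewrite normrN in h3; have h4 := normr_ge0 m.
by rewrite lee_fin; nra.
Qed.

(** The bound is independent of [i], as the minimum over endpoints requires. *)
Let fB_ge (psi : N -> R) (i : endpoint S0) x :
  (m - \sum_(j : endpoint S0) `|psi (sval j)|)%:E <= f i x - (psi (sval i))%:E.
Proof.
rewrite EFinB leeB// lee_fin (le_trans (ler_norm _))//.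
by rewrite (bigD1 i)//= lerDl sumr_ge0.
Qed.

Let measurable_fB (psi : N -> R) (i : endpoint S0) :
  measurable_fun [set: T] (fun x => f i x - (psi (sval i))%:E).
Proof. by apply: emeasurable_funB => //; exact: measurable_cst. Qed.

Lemma transport_weak_dual nu p (psi : N -> R) :
  measure_split mu nu -> within_limits a b p ->
  transport_dual psi <= transport_cost nu p + (\sum_n psi n * residual nu p n)%:E.
Proof.
move=> snu pab; rewrite transport_lagrangian// /transport_dual.
set h := fun x => \big[mine/+oo]_i (f i x - (psi (sval i))%:E).
have mh : measurable_fun [set: T] h by apply: measurable_bigmine.
have hm x : (m - \sum_(j : endpoint S0) `|psi (sval j)|)%:E <= h x.
  by apply: le_bigmin => [|i _]; [exact: leey|exact: fB_ge].
rewrite leeD//.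
  rewrite leeD2r// -(measure_split_integral muT snu mh hm); apply: lee_sum => i _.
  have nuT := measure_split_lty muT snu i.
  apply: (le_integral_bounded_below nuT mh (measurable_fB psi i) hm) => x.
  exact: bigmin_le.
by apply: lee_sum => e _; apply: ereal_inf_lbound; exists (p e) => //; exact: pab.
Qed.

Lemma transport_dual_attained (psi : N -> R) : (forall e, (a e <= b e)%R) ->
  exists nu p, [/\ measure_split mu nu, within_limits a b p &
   transport_dual psi = transport_cost nu p + (\sum_n psi n * residual nu p n)%:E].
Proof.
move=> ab.
have [nu snu nuE] := measure_split_argmin (point : endpoint S0) muT
  (measurable_fB psi) (fB_ge psi).
have /choice[p pP] e : exists p, (a e <= p <= b e)%R /\
    ereal_inf [set carc e r - ((psi (sval e).1 - psi (sval e).2) * r)%:E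
      | r in [set r : R | (a e <= r <= b e)%R]] =
    carc e p - ((psi (sval e).1 - psi (sval e).2) * p)%:E.
  have cab : compact `[a e, b e]%classic by exact: segment_compact.
  have gNy r : -oo < carc e r - ((psi (sval e).1 - psi (sval e).2) * r)%:E.
    by rewrite ltNye adde_eq_ninfty negb_or -ltNye carc_gtNy.
  have [|r rab rmin] := lsc_compact_min
      (lsc_sub_linear (k := (psi (sval e).1 - psi (sval e).2)%R) (@carc_lsc e)) gNy cab.
    by exists (a e); rewrite /= in_itv/= lexx ab.
  exists r; split; first by move: rab; rewrite /= in_itv.
  apply/eqP; rewrite eq_le; apply/andP; split.
    by apply: ereal_inf_lbound; exists r => //; move: rab; rewrite /= in_itv.
  by apply: le_ereal_inf_tmp => _ [r' r'ab <-]; apply: rmin; rewrite /= in_itv.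
exists nu, p; split => //; first by move=> e; case: (pP e).
rewrite transport_lagrangian// /transport_dual -nuE; congr (_ + _).
by apply: eq_bigr => e _; case: (pP e).
Qed.

(** Residuals are finite sums of convergent reals and pass to the limit exactly; costs pass only
    semi-continuously, which is enough for upper bounds on the cost. *)
Lemma transport_compact (U : set_system nat)
    (nu : nat -> endpoint S0 -> {measure set T -> \bar R}) (p : nat -> arcType A -> R) :
  UltraFilter U ->
  (forall n, measure_split mu (nu n)) -> (forall n, within_limits a b (p n)) ->
  exists nu' p', [/\ measure_split mu nu', within_limits a b p',
    forall k, residual (nu n) (p n) k @[n --> U] --> residual nu' p' k &
    lsc_along U (fun n => transport_cost (nu n) (p n)) (transport_cost nu' p')].
Proof.
move=> UU snu pab.
have nuT n i := measure_split_lty muT (snu n) i.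
have /choice[nu' nu'P] : forall i, exists nu' : {measure set T -> \bar R},
    forall B, measurable B ->
    nu' B <= mu B /\ fine (nu n i B) @[n --> U] --> fine (nu' B).
  move=> i; apply: (setwise_ultralimit UU muT) => n B.
  exact: measure_split_le.
have /choice[p' p'P] : forall e, exists l, (a e <= l <= b e)%R /\ p n e @[n --> U] --> l.
  by move=> e; have [l] := ultra_cvg_bounded UU (fun n => pab n e); exists l.
have nu'T i : nu' i [set: T] < +oo by rewrite (le_lt_trans _ muT)// (nu'P i _ _).1.
have fin (k : {measure set T -> \bar R}) B :
    k [set: T] < +oo -> measurable B -> k B \is a fin_num.
  by move=> kT mB; rewrite ge0_fin_numE// (le_lt_trans _ kT)// le_measure// inE.
have snu' : measure_split mu nu'.
  move=> B mB; rewrite -EFin_sum_fine; last by move=> i _; exact: fin.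
  rewrite -[RHS]fineK ?fin//; congr _%:E.
  have h : (\sum_i fine (nu n i B))%R @[n --> U] --> (\sum_i fine (nu' i B))%R.
    by apply: cvg_big => [|i _]; [exact: add_continuous|exact: (nu'P i _ mB).2].
  have h' : (\sum_i fine (nu n i B))%R @[n --> U] --> fine (mu B).
    apply: cvg_near_cst; apply: nearW => n; rewrite sum_fine ?snu//.
    by move=> i _; exact: fin.
  exact: (cvg_unique _ h h').
exists nu', p'; split => //.
- by move=> e; case: (p'P e).
- move=> k; rewrite /residual /net_outflow; apply: cvgB; last first.
    apply: cvgB; apply: cvg_big => [|e _]; try exact: add_continuous;
      exact: (p'P e).2.
  apply: cvgB; first exact: cvg_cst.
  by apply: cvg_big => [|i _]; [exact: add_continuous|exact: (nu'P i _ _).2].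
apply: lsc_alongD.
- apply: sume_gtNy => i; apply: lt_le_trans (integral_ge_lbound (nu'T i) (@mf i) (@fm i)).
  exact: ltNyr.
- exact: sume_gtNy.
- apply: lsc_along_sum => i.
    apply: lt_le_trans (integral_ge_lbound (nu'T i) (@mf i) (@fm i)); exact: ltNyr.
  apply: (integral_lsc_along _ _ _ _ (@mf i) (@fm i)) => // B mB.
  exact: (nu'P i _ mB).2.
- apply: lsc_along_sum => // e r rp.
  have [V Vx Vr] := @carc_lsc e (p' e) r rp.
  have h : \forall n \near U, V (p n e) := (p'P e).2 _ Vx.
  by apply: filterS h => n; exact: Vr.
Qed.

(** An epigraph: bounding the cost instead of prescribing it makes the set convex and stable under
    limits, and keeps the last coordinate real. *)
Let feasible_set : set ((N -> R) * R) := [set u | exists nu p,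
  [/\ measure_split mu nu, within_limits a b p,
    forall n, residual nu p n = u.1 n & transport_cost nu p <= u.2%:E]].

Let feasible_set_conv (u v : (N -> R) * R) (t : R) :
  feasible_set u -> feasible_set v -> (0 <= t <= 1)%R ->
  feasible_set (fun i => t * u.1 i + (1 - t) * v.1 i, t * u.2 + (1 - t) * v.2)%R.
Proof.
move=> [nu [p [snu pab nures nucost]]] [nu' [p' [snu' p'ab nu'res nu'cost]]] t01.
have [nut snut [nutE nutI]] := measure_split_conv muT snu snu' t01.
have /andP[t0 t1] := t01; have t1' : (0 <= 1 - t)%R by rewrite subr_ge0.
exists nut, (fun e => t * p e + (1 - t) * p' e)%R; split => //.
- move=> e; have /andP[ap pb] := pab e; have /andP[ap' pb'] := p'ab e.
  by apply/andP; split; nra.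
- move=> n; rewrite /= -nures -nu'res /residual /net_outflow !big_split/= -!mulr_sumr.
  have -> : (\sum_(i : endpoint S0 | sval i == n) fine (nut i [set: T]) =
      t * (\sum_(i : endpoint S0 | sval i == n) fine (nu i [set: T])) +
      (1 - t) * (\sum_(i : endpoint S0 | sval i == n) fine (nu' i [set: T])))%R.
    rewrite !mulr_sumr -big_split/=; apply: eq_bigr => i _.
    have nuT := measure_split_lty muT snu i; have nu'T := measure_split_lty muT snu' i.
    rewrite nutE -(@fineK _ (nu i _)) ?ge0_fin_numE//.
    by rewrite -(@fineK _ (nu' i _)) ?ge0_fin_numE.
  ring.
have int_gtNy (k : endpoint S0 -> {measure set T -> \bar R}) (i : endpoint S0) :
    measure_split mu k -> -oo < \int[k i]_x f i x.
  move=> sk; have kT := measure_split_lty muT sk i.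
  exact: lt_le_trans (ltNyr _) (integral_ge_lbound kT (@mf i) (@fm i)).
(* No summand is [-oo], so every sum below is defined and scalars distribute over it. *)
have addNy (x y : \bar R) : -oo < x -> -oo < y -> x +? y.
  by move=> xNy yNy; rewrite ltninfty_adde_def ?inE.
apply: (@le_trans _ _ (t%:E * transport_cost nu p + (1 - t)%:E * transport_cost nu' p')).
  rewrite /transport_cost !muleDr//; last 2 first.
  - by apply: addNy; apply: sume_gtNy => // i; exact: int_gtNy.
  - by apply: addNy; apply: sume_gtNy => // i; exact: int_gtNy.
  rewrite addeACA leeD//.
    rewrite !fin_num_sume_distrr//; last 2 first.
    - by move=> i j _ _; apply: addNy; exact: int_gtNy.
    - by move=> i j _ _; apply: addNy; exact: int_gtNy.
    rewrite -big_split/=; apply: lee_sum => i _.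
    by rewrite (nutI i (f i) m).
  rewrite !fin_num_sume_distrr//; last 2 first.
  - by move=> i j _ _; exact: addNy.
  - by move=> i j _ _; exact: addNy.
  by rewrite -big_split/=; apply: lee_sum => e _; exact: carc_convex.
by rewrite /= (EFinD (t * u.2)) !EFinM leeD// lee_wpmul2l// lee_fin.
Qed.

Let feasible_set_nearest (M : R) : feasible_set !=set0 ->
  exists2 z, feasible_set z & forall u, feasible_set u ->
    ((z.2 - M) ^+ 2 + \sum_i z.1 i ^+ 2 <= (u.2 - M) ^+ 2 + \sum_i u.1 i ^+ 2)%R.
Proof.
move=> [u0 Cu0].
pose Q (u : (N -> R) * R) := ((u.2 - M) ^+ 2 + \sum_i u.1 i ^+ 2)%R.
have Q0 u : (0 <= Q u)%R.
  by rewrite addr_ge0 ?sqr_ge0// sumr_ge0// => i _; exact: sqr_ge0.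
pose QC := Q @` feasible_set.
have QCinf : has_inf QC.
  by split; [exists (Q u0), u0|exists 0%R => _ [u _ <-]].
have /choice[u uP] : forall n : nat, exists u,
    feasible_set u /\ (Q u < inf QC + n.+1%:R^-1)%R.
  move=> n; have e0 : (0 < n.+1%:R^-1 :> R)%R by rewrite invr_gt0.
  by have [_ [u Cu <-] Qu] := inf_adherent e0 QCinf; exists u.
(* One ultrafilter finer than convergence at infinity selects the limits of measures, flows and cost
   bounds together, replacing successive subsequences. *)
have [U [UU sU]] := ultraFilterLemma (@eventually_filter).
have /choice[w wP] : forall n, exists w : (endpoint S0 -> {measure set T -> \bar R}) *
    (arcType A -> R), [/\ measure_split mu w.1, within_limits a b w.2,
      forall k, residual w.1 w.2 k = (u n).1 k &
      transport_cost w.1 w.2 <= (u n).2%:E].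
  by move=> n; have [[nu [p nup]] _] := uP n; exists (nu, p).
have sw n : measure_split mu (w n).1 by have [] := wP n.
have wab n : within_limits a b (w n).2 by have [] := wP n.
have [nu [p [snu pab wnu costnu]]] := transport_compact UU sw wab.
have inf0 : (0 <= inf QC)%R.
  by apply: lb_le_inf; [exists (Q u0), u0|move=> _ [v _ <-]].
(* The squared deviation from [M] is at most [inf QC + 1], itself at most [(inf QC + 2) ^+ 2]; this
   avoids a square root. *)
have [t _ ut] : exists2 t, (M - (inf QC + 2) <= t <= M + (inf QC + 2))%R &
    (u n).2 @[n --> U] --> t.
  apply: (ultra_cvg_bounded UU) => n.
  have : (((u n).2 - M) ^+ 2 <= inf QC + 1)%R.
    have [_ /ltW Qu] := uP n; apply: (@le_trans _ _ (Q (u n))).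
      by rewrite /Q lerDl sumr_ge0// => i _; exact: sqr_ge0.
    by rewrite (le_trans Qu)// lerD2l invf_le1// ler1n.
  by move=> h; apply/andP; split; nra.
have u1 k : (u n).1 k @[n --> U] --> residual nu p k.
  apply: cvg_trans (wnu k); apply: near_eq_cvg; apply: nearW => n.
  by have [_ _ ->] := wP n.
exists (residual nu p, t).
  exists nu, p; split => //=.
  by apply: (lsc_along_le _ costnu ut); apply: nearW => n; have [_ _ _ ] := wP n.
move=> v Cv; apply: (@le_trans _ _ (inf QC)); last first.
  by apply: ge_inf; [case: QCinf|exists v].
have Qu : Q (u n) @[n --> U] --> Q (residual nu p, t).
  apply: cvgD.
    have h : ((u n).2 - M)%R @[n --> U] --> (t - M)%R.
      by apply: cvgB => //; exact: cvg_cst.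
    by rewrite expr2; under eq_fun do rewrite expr2; exact: cvgM.
  apply: cvg_big => [|i _]; first exact: add_continuous.
  by rewrite expr2; under eq_fun do rewrite expr2; apply: cvgM; exact: u1.
have hinf : (inf QC + n.+1%:R^-1)%R @[n --> U] --> inf QC.
  rewrite -[X in _ --> X]addr0; apply: cvgD; first exact: cvg_cst.
  by apply: cvg_trans (@cvg_harmonic R); apply: cvg_app; exact: sU.
apply: (ler_cvg_to Qu hinf); apply: nearW => n; apply/ltW.
exact: (uP n).2.
Qed.

Lemma transport_dual_le (M : R) : (forall e, (a e <= b e)%R) ->
  (forall psi, transport_dual psi <= M%:E) ->
  exists nu p, [/\ measure_split mu nu, within_limits a b p,
    forall n, residual nu p n = 0%R & transport_cost nu p <= M%:E].
Proof.
move=> ab dualM.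
have [m' cost_ge] := transport_cost_ge ab.
have dual psi : exists2 u, feasible_set u & (u.2 + \sum_i psi i * u.1 i <= M)%R.
  have [nu [p [snu pab dE]]] := transport_dual_attained psi ab.
  have := dualM psi; rewrite dE; have := cost_ge _ _ snu pab.
  (* The cost is finite: it is bounded below, and [+oo] would carry the dual value above [M]. *)
  case cE : (transport_cost nu p) => [r| |]// _ h.
  exists (residual nu p, r); last by rewrite -lee_fin EFinD.
  by exists nu, p; split => //; rewrite cE.
have [|z Cz zmin] := feasible_set_nearest M.
  by have [u Cu _] := dual (fun=> 0%R); exists u.
have [z0 zM] : (forall i, z.1 i = 0%R) /\ z.2 = M.
  apply: (@nearest_point_dual R N feasible_set m' M z feasible_set_conv) => //.
  - move=> y t t' [nu [p [snu pab nures nucost]]] tt'; exists nu, p; split => //.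
    by rewrite (le_trans nucost)// lee_fin.
  - move=> u [nu [p [snu pab _ nucost]]].
    by rewrite -lee_fin (le_trans _ nucost)// cost_ge.
have [nu [p [snu pab nures nucost]]] := Cz.
by exists nu, p; split => //; [move=> n; rewrite nures z0|rewrite -zM].
Qed.

End transport.

(** * Borel measurability and Radon measures *)

Lemma borel_open (X : ptopologicalType) (U : set (borelType X)) :
  open (U : set X) -> measurable U.
Proof. exact: sub_sigma_algebra. Qed.

Lemma borel_compact (X : ptopologicalType) (K : set (borelType X)) :
  hausdorff_space X -> compact (K : set X) -> measurable K.
Proof.
move=> hX cK; rewrite -[K]setCK; apply: measurableC; apply: borel_open.
by have /closed_openC := @compact_closed X K hX cK.
Qed.

Lemma borel_continuous (X Y : ptopologicalType) (f : X -> Y) :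
  continuous f -> measurable_fun [set: borelType X] (f : borelType X -> borelType Y).
Proof.
move=> cf; apply: (@measurability _ _ (borelType X) (borelType Y) _ f (@open Y)) => //.
by move=> _ [U oU <-]; rewrite setTI; apply: borel_open; exact: open_comp.
Qed.

Lemma borel_lsc (R : realType) (X : ptopologicalType) (f : X -> \bar R) :
  lower_semicontinuous f -> measurable_fun [set: borelType X] (f : borelType X -> \bar R).
Proof.
move=> flsc; apply: (measurability _ (ErealGenOInfty.measurableE R)).
move=> /= _ [_ [a ->]] <-; rewrite setTI; apply: borel_open.
by rewrite preimage_itvoy; move/lower_semicontinuousP : flsc; exact.
Qed.

(** Sets whose complement lies in a Borel set of finite mass form a filter, proper if [mu] is
    infinite. A cluster point would have an open neighbourhood of finite mass, whose complement
    belongs to the filter. *)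
Lemma radon_compact_lty (R : realType) (X : ptopologicalType)
    (mu : {measure set (borelType X) -> \bar R}) :
  radon mu -> compact [set: X] -> mu [set: X] < +oo.
Proof.
move=> [mufin _] cX; rewrite ltNge; apply/negP => muX.
pose F : set_system X := [set A | exists2 B : set (borelType X),
  measurable B & ~` A `<=` B /\ mu B < +oo].
have FF : ProperFilter F.
  split; first move=> [B mB [B0 muB]].
    have := lt_le_trans muB muX; suff -> : B = [set: X] by rewrite ltxx.
    by apply/seteqP; split => // x _; apply: B0 => -[].
  split.
  - exists set0; [exact: measurable0|split; last by rewrite measure0 ltry].
    by rewrite setCT.
  - move=> P Q [B mB [PB muB]] [C mC [QC muC]].
    exists (B `|` C); first exact: measurableU.
    split; first by rewrite setCI; exact: setUSS.
    by rewrite (le_lt_trans (measureU2 _ mB mC))// lte_add_pinfty.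
  - move=> P Q PQ [B mB [PB muB]]; exists B => //; split => //.
    by apply: subset_trans PB; exact: subsetC.
have [x [_ Fx]] := cX F FF filterT.
have [U [oU Ux muU]] := mufin x.
have FU : F (~` U) by exists U; [exact: borel_open|split; rewrite ?setCK].
by have [y []] := Fx _ _ FU (open_nbhs_nbhs (conj oU Ux)).
Qed.

(** * Measures on the product with the finite discrete endpoint space *)

Section bridge.
Context (R : realType) (X : ptopologicalType) (N : finType) (S : {set N})
  (S0 : exists i, i \in S).
Local Notation I := (endpoint S0).
Local Notation XI := (borelType (X * endpoint S0)%type).

Definition slice (i : I) (x : borelType X) : XI := (x, i).

Lemma slice_continuous (i : I) : continuous (fun x : X => (x, i) : X * I).
Proof.
move=> x P [[A B] [/= xA iB] ABP].
have iBi : B i := nbhs_singleton iB.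
by apply: (@filterS X (nbhs x) _ A) => // y Ay; exact: (ABP (y, i)).
Qed.

Lemma measurable_slice (i : I) : measurable_fun [set: borelType X] (slice i).
Proof. exact: (@borel_continuous X (X * I)%type _ (@slice_continuous i)). Qed.

Definition proj (z : XI) : borelType X := z.1.

Lemma measurable_proj : measurable_fun [set: XI] proj.
Proof. by apply: (@borel_continuous (X * I)%type X fst) => z; exact: cvg_fst. Qed.

Lemma measurable_layer (i : I) : measurable ([set: X] `*` [set i] : set XI).
Proof.
have -> : [set: X] `*` [set i] = snd @^-1` [set i] :> set (X * I).
  by apply/seteqP; split => // -[x j] [].
apply: borel_open; apply: open_comp; last exact: discrete_open.
by move=> z _; exact: cvg_snd.
Qed.

Lemma measurable_setX1 (i : I) (B : set (borelType X)) :
  measurable B -> measurable (B `*` [set i] : set XI).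
Proof.
move=> mB.
have -> : B `*` [set i] = proj @^-1` B `&` ([set: X] `*` [set i]).
  by apply/seteqP; split => [[x j] [Bx ji]|[x j] [Bx [_ ji]]]; split.
apply: measurableI; last exact: measurable_layer.
by rewrite -[X in measurable X]setTI; exact: measurable_proj.
Qed.

Lemma hausdorff_setX_endpoint : hausdorff_space X -> hausdorff_space (X * I)%type.
Proof.
move=> hX [x i] [y j] cl.
have nbX (z : X * I) (C : set X) (D : set I) :
    nbhs z.1 C -> nbhs z.2 D -> nbhs z (C `*` D) by exists (C, D).
congr pair.
  apply: hX => C D Cx Dy.
  have [[z k] [[/= Cz _] [/= Dz _]]] := cl _ _
    (nbX (x, i) C setT Cx filterT) (nbX (y, j) D setT Dy filterT).
  by exists z.
have nb1 (k : I) : nbhs k [set k].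
  by apply: open_nbhs_nbhs; split => //; exact: discrete_open.
by have [[z k] [[/= _ <-] [/= _ <-]]] := cl _ _
  (nbX (x, i) setT _ filterT (nb1 i)) (nbX (y, j) setT _ filterT (nb1 j)).
Qed.

Section layer.
Variables (pi : {measure set XI -> \bar R}) (i : I).

Definition layer (B : set (borelType X)) : \bar R := pi (B `*` [set i]).

Let layer0 : layer set0 = 0.
Proof. by rewrite /layer set0X measure0. Qed.

Let layer_ge0 B : 0 <= layer B. Proof. exact: measure_ge0. Qed.

Let layer_sigma_additive : semi_sigma_additive layer.
Proof.
move=> F mF tF mUF.
have UE : (\bigcup_n F n) `*` [set i] = \bigcup_n (F n `*` [set i]).
  by apply/seteqP; split => -[x j] => [[[n _ Fx] ji]|[n _ [Fx ji]]];
    [exists n|split => //; exists n].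
rewrite /layer UE; apply: measure_semi_sigma_additive.
- by move=> n; exact: measurable_setX1.
- apply/trivIsetP => j k _ _ jk; apply/seteqP; split => // -[x l] [[Fj _] [Fk _]].
  have : (F j `&` F k) x by [].
  by move/trivIsetP : tF => /(_ _ _ Logic.I Logic.I jk) ->.
- by rewrite -UE; exact: measurable_setX1.
Qed.

HB.instance Definition _ :=
  isMeasure.Build _ _ _ layer layer0 layer_ge0 layer_sigma_additive.

(** A change of variables: [layer] is the image under [proj] of [pi] restricted to the copy of [X]
    at [i]. Positive and negative parts are handled apart because integrals may be infinite. *)
Lemma integral_layer (f : X * I -> \bar R) :
  measurable_fun [set: XI] (f : XI -> \bar R) ->
  \int[pi]_(z in [set: X] `*` [set i]) f z = \int[layer]_x f (x, i).
Proof.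
suff ge0 g : measurable_fun [set: XI] (g : XI -> \bar R) -> (forall z, 0 <= g z) ->
    \int[pi]_(z in [set: X] `*` [set i]) g z = \int[layer]_x g (x, i).
  move=> mf; rewrite integralE [RHS]integralE; congr (_ - _).
    rewrite ge0; [|exact: measurable_funepos|by move=> z; exact: funepos_ge0].
    by apply: eq_integral => x _; rewrite !funeposE.
  rewrite ge0; [|exact: measurable_funeneg|by move=> z; exact: funeneg_ge0].
  by apply: eq_integral => x _; rewrite !funenegE.
move=> mg g0; pose D := [set: X] `*` [set i] : set XI.
have mD : measurable D := measurable_layer i.
have mgi : measurable_fun [set: borelType X] (fun x : borelType X => g (x, i)).
  exact: (measurableT_comp mg (measurable_slice i)).
have -> : \int[layer]_x g (x, i) = \int[pushforward (mrestr pi mD) proj]_x g (x, i).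
  congr (integral _ _ _); apply/funext => B; rewrite /layer /pushforward /mrestr.
  by congr (pi _); apply/seteqP; split => [[x j] [Bx ji]|[x j] [Bx [_ ji]]]; split.
rewrite (ge0_integral_pushforward measurable_proj)//.
rewrite preimage_setT.
(* The restricted measure does not charge the complement of [D], and on [D] a point [z] equals
   [(proj z, i)]. *)
rewrite (@ge0_negligible_integral _ _ _ (mrestr pi mD) _ (~` D))//.
- rewrite setTD setCK; transitivity (\int[mrestr pi mD]_(z in D) g z).
    by apply: eq_measure_integral => B mB BD; rewrite /= /mrestr setIidl.
  by apply: eq_integral => -[x j] /[!inE] -[_ /= ->].
- exact: measurableC.
- exact: (measurableT_comp mgi measurable_proj).
- by move=> z _; exact: g0.
- by rewrite /= /mrestr setICl measure0.
Qed.

End layer.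

Section glue.
Variable nu : I -> {measure set (borelType X) -> \bar R}.

Definition glue (B : set XI) : \bar R := \sum_i nu i (slice i @^-1` B).

Let glue0 : glue set0 = 0.
Proof. by rewrite /glue big1// => i _; rewrite preimage_set0 measure0. Qed.

Let glue_ge0 B : 0 <= glue B. Proof. exact: sume_ge0. Qed.

Lemma measurable_slice_preimage (i : I) (B : set XI) :
  measurable B -> measurable (slice i @^-1` B).
Proof. by move=> mB; rewrite -[X in measurable X]setTI; exact: measurable_slice. Qed.

Let glue_sigma_additive : semi_sigma_additive glue.
Proof.
move=> F mF tF mUF.
have -> : (fun n => \sum_(0 <= k < n) glue (F k)) =
    (fun n => \sum_i \sum_(0 <= k < n) nu i (slice i @^-1` F k)).
  by apply/funext => n; rewrite exchange_big.
apply: cvg_nnesum => i _; first by apply: nearW => n; exact: sume_ge0.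
rewrite preimage_bigcup; apply: measure_semi_sigma_additive.
- by move=> n; exact: measurable_slice_preimage.
- apply/trivIsetP => j k _ _ jk; rewrite -preimage_setI.
  by move/trivIsetP : tF => /(_ _ _ Logic.I Logic.I jk) ->; rewrite preimage_set0.
- by rewrite -preimage_bigcup; exact: measurable_slice_preimage.
Qed.

HB.instance Definition _ :=
  isMeasure.Build _ _ _ glue glue0 glue_ge0 glue_sigma_additive.

Lemma glueX1 (i : I) (B : set (borelType X)) : glue (B `*` [set i]) = nu i B.
Proof.
rewrite /glue (bigD1 i)//= big1 ?adde0.
  by congr (nu i _); apply/seteqP; split => x => [[]|].
move=> j ji; rewrite (_ : _ @^-1` _ = set0) ?measure0//.
by apply/seteqP; split => // x [_ /= ij]; rewrite ij eqxx in ji.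
Qed.

Variable mu : {measure set (borelType X) -> \bar R}.
Hypothesis X_hausdorff : hausdorff_space X.
Hypothesis muX : mu [set: X] < +oo.
Hypothesis mu_radon : radon mu.
Hypothesis nusplit : measure_split mu nu.

Let glue_fin : fin_num_fun glue.
Proof.
move=> B mB; apply/sum_fin_numP => i _ _.
rewrite ge0_fin_numE//; apply: le_lt_trans (measure_split_lty muX nusplit i).
by apply: le_measure; rewrite ?inE//; exact: measurable_slice_preimage.
Qed.

Definition glue_finite_measure : {finite_measure set XI -> \bar R} :=
  HB.pack glue (Measure_isFinite.Build _ _ _ glue glue_fin).

(* Each [nu i] inherits inner regularity from [mu] because [nu i <= mu < +oo]. *)
Lemma glue_radon : radon glue.
Proof.
split.
  move=> z; exists [set: X * I]; split => //; first exact: openT.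
  by rewrite -ge0_fin_numE// glue_fin.
have hXI := hausdorff_setX_endpoint X_hausdorff.
have mu_fin (D : set (borelType X)) : measurable D -> mu D \is a fin_num.
  move=> mD; rewrite ge0_fin_numE//; apply: le_lt_trans muX.
  by apply: le_measure; rewrite ?inE.
move=> B mB; apply/eqP; rewrite eq_le; apply/andP; split; last first.
  apply: ge_ereal_sup => _ [K [cK KB] <-]; apply: le_measure; rewrite ?inE//.
  exact: (@borel_compact (X * I)%type).
apply/lee_addgt0Pr => e e0.
(* The error [e] is shared among the endpoints; the successor makes the denominator visibly
   positive. *)
pose dl := (e / #|{: I}|.+1%:R)%R; have dl0 : (0 < dl)%R by rewrite divr_gt0.
have mBi i : measurable (slice i @^-1` B) by exact: measurable_slice_preimage.
have /choice[K KP] : forall i, exists K : set X, [/\ compact K, K `<=` slice i @^-1` B &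
    nu i (slice i @^-1` B) <= nu i K + dl%:E].
  move=> i; have [_ /(_ _ (mBi i)) supE] := mu_radon.
  have := mu_fin _ (mBi i); rewrite supE => /(ub_ereal_sup_adherent dl0).
  move=> [_ [K [cK KB] <-]]; rewrite -supE => muK.
  have mK : measurable (K : set (borelType X)) by exact: borel_compact.
  exists K; split => //.
  rewrite (measureDI (nu i) (mBi i) mK) addeC setIidr// leeD2l//.
  apply: le_trans (measure_split_le nusplit i _) _; first exact: measurableD.
  rewrite measureD//; last by rewrite -ge0_fin_numE// mu_fin.
  by rewrite setIidr// leeBlDr ?mu_fin// addeC -leeBlDr// ltW.
pose L := \bigcup_(i in [set` index_enum I]) (K i `*` [set i]) : set (X * I).
have cL : compact L.
  rewrite /L bigcup_seq; apply: bigsetU_compact => i _.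
  apply: compact_setX; first by case: (KP i).
  exact: compact_set1.
have LB : L `<=` B by move=> [x j] [i _ [/= Kx ->]]; have [_ + _] := KP i; exact.
apply: (@le_trans _ _ (glue L + e%:E)); last first.
  by rewrite leeD2r//; apply: ereal_sup_ubound; exists L.
have LE i : slice i @^-1` L = K i.
  apply/seteqP; split => [x [j _ [/= Kx ->]]|x Kx] //.
  by exists i => //=; exact: mem_index_enum.
apply: (@le_trans _ _ (\sum_(i : I) (nu i (K i) + dl%:E))).
  by apply: lee_sum => i _; have [] := KP i.
rewrite big_split/= /glue; under [X in _ <= X + _]eq_bigr do rewrite LE.
rewrite leeD2l// sumEFin lee_fin sumr_const.
rewrite -mulr_natr /dl -mulrA; apply: ler_piMr; first exact: ltW.
by rewrite mulrC ler_pdivrMr// mul1r ler_nat.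
Qed.

Let marginal_le (E : set X) : \sum_(i : I) mu_ext glue (E `*` [set i]) <= mu_ext mu E.
Proof.
apply: le_ereal_inf_tmp => _ [F [mF EF] <-].
have mUF : measurable (\bigcup_k F k) by exact: bigcupT_measurable.
apply: (@le_trans _ _ (mu (\bigcup_k F k))); last exact: measure_sigma_subadditive.
rewrite -nusplit//; apply: lee_sum => i _.
rewrite -(glueX1 i) -measurable_mu_extE; last exact: measurable_setX1.
by apply: le_mu_ext => -[x j] [/EF].
Qed.

(** One inequality holds for every set, by gluing Borel covers. The other follows by applying it to
    the complement: [mu_ext mu] is additive on [E] and its complement, while the outer measure of
    [glue] is subadditive and has the same total mass. *)
Lemma glue_marginal (E : set X) : mu_measurable mu E ->
  \sum_(i : I) mu_ext glue (E `*` [set i]) = mu_ext mu E.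
Proof.
move=> mE; apply/eqP; rewrite eq_le marginal_le/=.
have mu_ext_fin (F : set X) : mu_ext mu F \is a fin_num.
  rewrite ge0_fin_numE ?mu_ext_ge0//; apply: le_lt_trans muX.
  by rewrite -[leRHS]measurable_mu_extE//; exact: le_mu_ext.
have sum_fin (F : set X) : \sum_(i : I) mu_ext glue (F `*` [set i]) \is a fin_num.
  rewrite ge0_fin_numE ?sume_ge0//; last by move=> i _; exact: mu_ext_ge0.
  by apply: le_lt_trans (marginal_le F) _; rewrite -ge0_fin_numE ?mu_ext_ge0.
rewrite -(leeD2rE _ _ (sum_fin (~` E))).
apply: (@le_trans _ _ (mu_ext mu E + mu_ext mu (~` E))); first by rewrite leeD2l.
have := mE [set: X]; rewrite !setTI => <-.
rewrite measurable_mu_extE// -nusplit// -big_split/=; apply: lee_sum => i _.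
rewrite -(glueX1 i) -measurable_mu_extE; last exact: measurable_setX1.
rewrite -(setvU E) setUC.
rewrite (_ : (E `|` ~` E) `*` [set i] = E `*` [set i] `|` (~` E) `*` [set i]).
  exact: outer_measureU2.
apply/seteqP; split => -[x j] => [[[Ex|Ex] ji]|[[Ex ji]|[Ex ji]]];
  do ?[by left|by right]; split => //; [by left|by right].
Qed.

End glue.

End bridge.

(** * Feasible plans and splittings of [mu] *)

(** The fibres need only be Caratheodory measurable, so finite additivity is applied to [mu_ext mu]
    as a measure on [caratheodory_type]. *)
Lemma mu_ext_partition d (T : measurableType d) (R : realType) (I : finType)
    (mu : {measure set T -> \bar R}) (t : T -> I) :
  (forall i, (mu_ext mu).-caratheodory (t @^-1` [set i])) ->
  \sum_i mu_ext mu (t @^-1` [set i]) = mu [set: T].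
Proof.
move=> mt; rewrite -measurable_mu_extE//.
pose om : {outer_measure set T -> \bar R} := mu_ext mu.
have := @measure_bigcup_fin _ (caratheodory_type om) R I om
  (fun i => t @^-1` [set i]) mt.
rewrite /= => <-; last first.
  apply/trivIsetP => i j _ _ ij; apply/seteqP; split => // x [/= ti tj].
  by rewrite -ti tj eqxx in ij.
by congr (mu_ext mu _); apply/seteqP; split => // x _; exists (t x).
Qed.

Section kantorovich.
Context (R : realType) (X : ptopologicalType)
  (mu : {measure set (borelType X) -> \bar R})
  (N : finType) (A : {set N * N}) (S : {set N}) (S0 : exists i, i \in S)
  (s : N -> R) (c : X * endpoint S0 -> \bar R)
  (carc : arcType A -> R -> \bar R) (a b : arcType A -> R).
Hypotheses (X_hausdorff : hausdorff_space X) (mu_radon : radon mu)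
  (muX : mu [set: X] < +oo).
Local Notation I := (endpoint S0).
Local Notation XI := (borelType (X * endpoint S0)%type).

Lemma residual_eq0 (nu : I -> {measure set (borelType X) -> \bar R})
    (p : arcType A -> R) :
  (forall n, residual s nu p n = 0%R) <->
  (forall i : I, net_outflow p (sval i) = s (sval i) - fine (nu i [set: X]))%R /\
  (forall n, n \notin S -> net_outflow p n = s n).
Proof.
have inS (i : I) : (\sum_(j : I | sval j == sval i) fine (nu j [set: X]) =
    fine (nu i [set: X]))%R by exact: (big_pred1 i).
have notinS n : n \notin S -> (\sum_(j : I | sval j == n) fine (nu j [set: X]) = 0)%R.
  move=> nS; rewrite big_pred0// => -[j jS] /=.
  by apply/eqP => jn; rewrite -jn jS in nS.
rewrite /residual; split => [r0|[netS netN] n].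
  split => [i|n nS]; [have := r0 (sval i)|have := r0 n]; rewrite ?inS ?notinS//; lra.
have [nS|nS] := boolP (n \in S); last by rewrite notinS// netN//; lra.
by have := inS (exist _ n nS); rewrite /= => ->; rewrite (netS (exist _ n nS)) /=; lra.
Qed.

Lemma kantorovich_layer (pi : {finite_measure set XI -> \bar R})
    (p : arcType A -> R) :
  kantorovich_feasible mu s a b pi p ->
  [/\ measure_split mu (layer pi), within_limits a b p &
    forall n, residual s (layer pi) p n = 0%R].
Proof.
move=> [_ netS netN marg pab].
have lsplit : measure_split mu (layer pi).
  move=> B mB; rewrite -[RHS]measurable_mu_extE// -marg; last first.
    by apply: sub_caratheodory; exact: sub_sigma_algebra.
  apply: eq_bigr => i _; rewrite measurable_mu_extE//.
  exact: measurable_setX1.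
split => //; apply/residual_eq0; split => // i.
apply: EFin_inj; rewrite netS EFinB fineK//.
by rewrite ge0_fin_numE// (measure_split_lty muX lsplit).
Qed.

Lemma kantorovich_glue (nu : I -> {measure set (borelType X) -> \bar R})
    (p : arcType A -> R)
    (snu : measure_split mu nu) : within_limits a b p ->
  (forall n, residual s nu p n = 0%R) ->
  kantorovich_feasible mu s a b (glue_finite_measure muX snu) p.
Proof.
move=> pab /residual_eq0[netS netN]; split => //.
- exact: (glue_radon X_hausdorff muX mu_radon snu).
- move=> i; rewrite netS EFinB fineK; first by rewrite /= glueX1.
  by rewrite ge0_fin_numE// (measure_split_lty muX snu).
- by move=> E mE; exact: glue_marginal.
Qed.

Lemma kantorovich_cost_layer (pi : {finite_measure set XI -> \bar R})
    (p : arcType A -> R) :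
  measurable_fun [set: XI] (c : XI -> \bar R) ->
  kantorovich_cost c carc pi p =
  transport_cost (fun (i : I) (x : borelType X) => c (x, i)) carc (layer pi) p.
Proof.
move=> mc; congr (_ + _); apply: eq_bigr => i _.
exact: integral_layer.
Qed.

Lemma kantorovich_cost_glue (nu : I -> {measure set (borelType X) -> \bar R})
    (p : arcType A -> R)
    (snu : measure_split mu nu) : measurable_fun [set: XI] (c : XI -> \bar R) ->
  kantorovich_cost c carc (glue_finite_measure muX snu) p =
  transport_cost (fun (i : I) (x : borelType X) => c (x, i)) carc nu p.
Proof.
move=> mc; rewrite kantorovich_cost_layer//; congr (_ + _); apply: eq_bigr => i _.
by apply: eq_measure_integral => B mB _; rewrite /= /layer/= glueX1.
Qed.

(* Spreading the mass of each fibre of [T] uniformly over [mu] keeps the flow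
   balance and avoids pushing [mu] forward along the merely [mu]-measurable [T]. *)
Lemma monge_split (T : X -> I) p : monge_feasible mu s a b T p ->
  exists2 nu : I -> {measure set (borelType X) -> \bar R},
    measure_split mu nu & forall n, residual s nu p n = 0%R.
Proof.
move=> [mT netS netN pab].
have sumT := @mu_ext_partition _ (borelType X) R I mu T (fun i => mT [set i]).
pose w i := mu_ext mu (T @^-1` [set i]).
have w0 i : 0 <= w i by exact: mu_ext_ge0.
have wle i : w i <= mu [set: X].
  by rewrite -sumT (bigD1 i)//= leeDl// sume_ge0// => j _; exact: w0.
have wfin i : w i \is a fin_num by rewrite ge0_fin_numE// (le_lt_trans (wle i)).
have mufin : mu [set: X] \is a fin_num by rewrite ge0_fin_numE.
have r0 i : (0 <= fine (w i) / fine (mu [set: X]))%R by rewrite divr_ge0// fine_ge0.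
pose nu i : {measure set (borelType X) -> \bar R} := mscale (NngNum (r0 i)) mu.
have nuE i B : nu i B = (fine (w i) / fine (mu [set: X]))%:E * mu B by [].
(* If [mu] is null the weights have denominator 0, but then the masses [nu i] and [w i] all
   vanish. *)
have [mu0|mu0] := eqVneq (mu [set: X]) 0.
  have muB0 B : measurable B -> mu B = 0.
    move=> mB; apply/eqP; rewrite -measure_le0 -mu0.
    by apply: le_measure; rewrite ?inE.
  exists nu.
    move=> B mB; rewrite (muB0 B mB) big1// => i _.
    by rewrite nuE (muB0 B mB) mule0.
  apply/residual_eq0; split => // i; rewrite nuE (muB0 _ measurableT) mule0 subr0.
  apply: EFin_inj; rewrite netS.
  have -> : mu_ext mu (T @^-1` [set i]) = 0; last by rewrite sube0.
  by apply/eqP; rewrite eq_le w0 andbT -mu0 wle.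
have m0 : fine (mu [set: X]) != 0%R by rewrite fine_eq0.
exists nu.
  move=> B mB; under eq_bigr do rewrite nuE.
  rewrite -ge0_sume_distrl => [|i _]; last by rewrite lee_fin.
  rewrite sumEFin -mulr_suml sum_fine; last by move=> i _; exact: wfin.
  by rewrite sumT divff// mul1e.
apply/residual_eq0; split => // i; rewrite nuE fineM// /= divfK//.
by apply: EFin_inj; rewrite netS EFinB fineK.
Qed.

End kantorovich.

Theorem theorem1 (R : realType) (X : ptopologicalType)
    (mu : {measure set (borelType X) -> \bar R})
    (N : finType) (A : {set N * N}) (S : {set N}) (S0 : exists i, i \in S)
    (s : N -> R) (c : X * endpoint S0 -> \bar R)
    (carc : arcType A -> R -> \bar R) (a b : arcType A -> R)
    (X_hausdorff : hausdorff_space X)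
    (mu_radon : radon mu)
    (c_lsc : lower_semicontinuous c)
    (c_bounded_below : exists m : R, forall z, m%:E <= c z)
    (X_compact : compact [set: X])
    (carc_gtNy : forall e r, -oo < carc e r)
    (carc_convex : forall e, econvex (carc e))
    (carc_lsc : forall e, lower_semicontinuous (carc e))
    (monge_ex : exists T p, @monge_feasible R X mu N A S S0 s a b T p) :
  kantorovich_value mu s c carc a b
    = ereal_sup [set dual_function mu s c carc a b psi | psi in [set: N -> R]]
  /\ exists pi p, kantorovich_feasible mu s a b pi p
       /\ kantorovich_cost c carc pi p = kantorovich_value mu s c carc a b.
Proof.
have [m cm] := c_bounded_below; have [T [p0 feas0]] := monge_ex.
have muX := radon_compact_lty mu_radon X_compact.
have p0ab : within_limits a b p0 by case: feas0.
have ab e : (a e <= b e)%R by have /andP[/le_trans] := p0ab e; apply.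
have mc : measurable_fun [set: borelType (X * endpoint S0)%type] c by exact: borel_lsc.
pose f (i : endpoint S0) (x : borelType X) := c (x, i).
have mf i : measurable_fun [set: borelType X] (f i).
  exact: (measurableT_comp mc (measurable_slice i)).
have fm i x : m%:E <= f i x by exact: cm.
set D := ereal_sup _; set K := kantorovich_value _ _ _ _ _ _.
have dualE psi :
  dual_function mu s c carc a b psi = transport_dual mu s f carc a b psi by [].
have DK : D <= K.
  apply: ge_ereal_sup => _ [psi _ <-]; apply: le_ereal_inf_tmp => _ [pi [p [pip ->]]].
  have [lsplit pab res0] := kantorovich_layer muX pip.
  rewrite dualE kantorovich_cost_layer//.
  have := transport_weak_dual s carc muX mf fm psi lsplit pab.
  by rewrite big1 ?adde0// => n _; rewrite res0 mulr0.
have dual_le psi : dual_function mu s c carc a b psi <= D.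
  by apply: ereal_sup_ubound; exists psi.
(* By weak duality, one feasible plan of cost at most [D] settles both the equality and the
   attainment. *)
have attained nu p (snu : measure_split mu nu) : within_limits a b p ->
    (forall n, residual s nu p n = 0%R) -> transport_cost f carc nu p <= D ->
    K = D /\ exists pi p, kantorovich_feasible mu s a b pi p /\
      kantorovich_cost c carc pi p = K.
  move=> pab res0 costD.
  have feas := kantorovich_glue X_hausdorff mu_radon muX snu pab res0.
  have costE := kantorovich_cost_glue carc muX p snu mc.
  have KD : K <= transport_cost f carc nu p.
    by apply: ereal_inf_lbound; exists (glue_finite_measure muX snu), p; rewrite costE.
  have -> : K = D by apply/eqP; rewrite eq_le DK (le_trans KD).
  split => //; exists (glue_finite_measure muX snu), p; split => //.
  by apply/eqP; rewrite costE eq_le costD (le_trans DK).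
(* Every feasible plan is optimal here, so what remains is that one exists. *)
have [D_infty|] := eqVneq D +oo.
  have [nu snu res0] := monge_split muX feas0.
  by apply: (attained nu p0) => //; rewrite D_infty leey.
case DE : D => [M| |] // _.
  have [|nu [p [snu pab res0 costM]]] :=
      transport_dual_le (s := s) muX mf fm carc_gtNy carc_convex carc_lsc ab (M := M).
    by move=> psi; rewrite -DE -dualE.
  by rewrite -DE; apply: (attained nu p) => //; rewrite DE.
(* The value [-oo] is excluded: at [psi = 0] the dual equals the cost of an actual pair, and costs
   are bounded below. *)
have [nu [p [snu pab dE]]] :=
  transport_dual_attained s muX mf fm carc_gtNy carc_lsc (fun=> 0%R) ab.
have [m' cost_ge] := transport_cost_ge muX mf fm carc_gtNy carc_lsc ab.
have := dual_le (fun=> 0%R); rewrite DE dualE dE leeNy_eq adde_eq_ninfty orbF.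
move=> /eqP cE; by have := lt_le_trans (ltNyr m') (cost_ge _ _ snu pab); rewrite cE.
Qed.
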